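(* Let $\Gamma=(X,R)$ be a bipartite distance-regular graph with diameter $D\ge4$ and valency $k\ge3$, fix $x\in X$, let $W$ be a thin irreducible $T(x)$-module with endpoint $2$ and local eigenvalue $\eta$ with $\tilde\theta_1<\eta<\tilde\theta_d$, and let $v$ be a nonzero vector in $E^*_2W$. Then the vectors $E^*_{i+2}A_iv$ $(0\le i\le D-2)$ are mutually orthogonal, and: (i) if $\eta\neq-1$, then with $\psi=b_2\bigl(1-\frac{b_3}{1+\eta}\bigr)$, $$\|E^*_{i+2}A_iv\|^2=\frac{k_ib_ib_{i+1}c_{i+1}c_{i+2}}{k\,b_1(\psi-b_2)}\,\frac{P_{i+2}(\psi)}{P_i(\psi)}\,\|v\|^2\qquad(0\le i\le D-2);$$ (ii) if $\eta=-1$, then $\|E^*_{i+2}A_iv\|^2=\frac{k_ib_ib_{i+1}}{k\,b_1}\|v\|^2$ for $0\le i\le D-2$.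
   Context: $\Gamma$ is a finite connected bipartite distance-regular graph with distance $\partial$, intersection numbers $c_i,b_i$ ($c_0=0,b_D=0$), $k_i=b_0\cdots b_{i-1}/(c_1\cdots c_i)$. $A_i$ distance matrices, $A=A_1$, eigenvalues $\theta_0>\dots>\theta_D$; $d=\lfloor D/2\rfloor$. $V=\mathbb{C}^X$ with $\langle u,w\rangle=u^t\bar w$, $\|u\|^2=\langle u,u\rangle$. $E^*_i$ diagonal with $(y,y)$-entry $1$ if $\partial(x,y)=i$, else $0$; $T(x)$ generated by $A,E^*_0,\dots,E^*_D$; thin: $\dim E^*_iW\le1$ for all $i$; endpoint $\min\{i:E^*_iW\ne0\}$; local eigenvalue of thin irreducible $W$ with endpoint 2: eigenvalue of $E^*_2A_2E^*_2$ on $E^*_2W$. $\tilde\theta_1=-1-b_2b_3(\theta_1^2-b_2)^{-1}$, $\tilde\theta_d=-1-b_2b_3(\theta_d^2-b_2)^{-1}$. Polynomials: $f_0=1,f_{-1}=0$, $\lambda f_i=b_{i-1}f_{i-1}+c_{i+1}f_{i+1}$; $p_i=f_i+f_{i-2}+\cdots$ (ending in $f_0$ or $f_1$ according to parity); $p_i(\lambda)=P_i(\lambda^2)$ for $i$ even, $p_i(\lambda)=\lambda P_i(\lambda^2)$ for $i$ odd. *)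

(* Defs.v *)
From mathcomp Require Import all_boot all_order all_algebra.
From mathcomp Require Import reals.
From mathcomp Require Export complex.

Set Implicit Arguments.
Unset Strict Implicit.
Unset Printing Implicit Defensive.

Import GRing.Theory Num.Theory.
Local Open Scope ring_scope.
Local Open Scope complex_scope.

(* A simple graph on the finite vertex set X is given by a symmetric
   irreflexive adjacency relation e : rel X. *)

Definition walk (X : finType) (e : rel X) (n : nat) (y z : X) : bool :=
  [exists p : n.-tuple X, path e y p && (last y p == z)].

(* Length of a shortest walk.  In a connected graph a shortest walk has length
   less than #|X|, so the search below always succeeds. *)
Definition gdist (X : finType) (e : rel X) (y z : X) : nat :=
  find (fun n => walk e n y z) (iota 0 #|X|).

Definition diameter (X : finType) (e : rel X) : nat :=
  (\max_(u : X * X) gdist e u.1 u.2)%N.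

Definition bipartite (X : finType) (e : rel X) : Prop :=
  exists side : X -> bool, forall y z, e y z -> side y != side z.

Definition sphere_meet (X : finType) (e : rel X) (i j : nat) (y z : X) : nat :=
  #|[set w | (gdist e y w == i) && (gdist e w z == j)]|.

(* |{w : dist(y,w) = i, dist(w,z) = j}| depends only on i, j and dist(y,z). *)
Definition distance_regular (X : finType) (e : rel X) : Prop :=
  forall (h i j : nat) (y z y' z' : X),
    gdist e y z = h -> gdist e y' z' = h ->
    sphere_meet e i j y z = sphere_meet e i j y' z'.

Definition bipartite_drg (X : finType) (e : rel X) : Prop :=
  [/\ symmetric e, irreflexive e, (forall y z, connect e y z),
      bipartite e & distance_regular e].

(* p^h_{ij}, evaluated at some pair of vertices at distance h; it is 0 if there
   is no such pair. *)
Definition inter_num (X : finType) (e : rel X) (h i j : nat) : nat :=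
  if [pick u : X * X | gdist e u.1 u.2 == h] is Some u
  then sphere_meet e i j u.1 u.2 else 0%N.

(* b_i = p^i_{1,i+1}, c_i = p^i_{1,i-1} and c_0 = 0; b_D = 0 holds since no two
   vertices are at distance D + 1. *)
Definition bnum (X : finType) (e : rel X) (i : nat) : nat :=
  inter_num e i 1 i.+1.
Definition cnum (X : finType) (e : rel X) (i : nat) : nat :=
  if i is j.+1 then inter_num e i 1 j else 0%N.

Definition knum (R : realType) (X : finType) (e : rel X) (i : nat) : R :=
  (\prod_(j < i) (bnum e j)%:R) / (\prod_(j < i) (cnum e j.+1)%:R).

(* Matrices are indexed by 'I_#|X| through the enumeration enum_val of X. *)
Definition dist_mx (F : pzRingType) (X : finType) (e : rel X) (i : nat) :
    'M[F]_#|X| :=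
  \matrix_(y, z) (gdist e (enum_val y) (enum_val z) == i)%:R.

(* theta_0 > ... > theta_D are the eigenvalues of the adjacency matrix. *)
Definition graph_eigenvalues (R : realType) (X : finType) (e : rel X)
    (theta : seq R) : Prop :=
  sorted >%R theta /\
  forall a : R, (a \in theta) = eigenvalue (dist_mx R e 1) a.

Definition theta_tilde (R : realType) (X : finType) (e : rel X) (t : R) : R :=
  -1 - (bnum e 2)%:R * (bnum e 3)%:R * (t ^+ 2 - (bnum e 2)%:R)^-1.

Definition dual_idempotent (F : pzRingType) (X : finType) (e : rel X) (x : X)
    (i : nat) : 'M[F]_#|X| :=
  \matrix_(y, z) ((y == z) && (gdist e x (enum_val y) == i))%:R.

Inductive in_terwilliger (F : fieldType) (X : finType) (e : rel X) (x : X) :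
    'M[F]_#|X| -> Prop :=
| Terwilliger_adj : in_terwilliger e x (dist_mx F e 1)
| Terwilliger_idem i : (i <= diameter e)%N ->
    in_terwilliger e x (dual_idempotent F e x i)
| Terwilliger_one : in_terwilliger e x 1%:M
| Terwilliger_add B C : in_terwilliger e x B -> in_terwilliger e x C ->
    in_terwilliger e x (B + C)
| Terwilliger_scale a B : in_terwilliger e x B -> in_terwilliger e x (a *: B)
| Terwilliger_mul B C : in_terwilliger e x B -> in_terwilliger e x C ->
    in_terwilliger e x (B *m C).

Definition T_module (F : fieldType) (X : finType) (e : rel X) (x : X)
    (W : {vspace 'cV[F]_#|X|}) : Prop :=
  forall B, in_terwilliger e x B -> forall w, w \in W -> B *m w \in W.

Definition T_irreducible (F : fieldType) (X : finType) (e : rel X) (x : X)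
    (W : {vspace 'cV[F]_#|X|}) : Prop :=
  [/\ T_module e x W, W != 0%VS &
      forall U : {vspace 'cV[F]_#|X|},
        (U <= W)%VS -> T_module e x U -> U = 0%VS \/ U = W].

(* The subspace E*_i W. *)
Definition layer (F : fieldType) (X : finType) (e : rel X) (x : X) (i : nat)
    (W : {vspace 'cV[F]_#|X|}) : {vspace 'cV[F]_#|X|} :=
  (linfun (mulmx (dual_idempotent F e x i)) @: W)%VS.

Definition thin (F : fieldType) (X : finType) (e : rel X) (x : X)
    (W : {vspace 'cV[F]_#|X|}) : Prop :=
  forall i, (i <= diameter e)%N -> (\dim (layer e x i W) <= 1)%N.

Definition has_endpoint (F : fieldType) (X : finType) (e : rel X) (x : X)
    (W : {vspace 'cV[F]_#|X|}) (r : nat) : Prop :=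
  layer e x r W != 0%VS /\ forall i, (i < r)%N -> layer e x i W = 0%VS.

(* eta is an eigenvalue of E*_2 A_2 E*_2 on E*_2 W; it is unique if W is thin
   with endpoint 2. *)
Definition local_eigenvalue (F : fieldType) (X : finType) (e : rel X) (x : X)
    (W : {vspace 'cV[F]_#|X|}) (eta : F) : Prop :=
  exists u : 'cV[F]_#|X|,
    [/\ u \in layer e x 2 W, u != 0 &
        dual_idempotent F e x 2 *m dist_mx F e 2 *m dual_idempotent F e x 2 *m u
        = eta *: u].

Definition hdot (R : realType) (n : nat) (u w : 'cV[R[i]]_n) : R[i] :=
  (u^T *m map_mx (@conjc R) w) 0 0.

(* f_i, obtained by solving  'X f_i = b_{i-1} f_{i-1} + c_{i+1} f_{i+1}  for
   f_{i+1}; meaningful for i <= D, where c_1, ..., c_D are nonzero. *)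
Fixpoint fpoly (R : realType) (X : finType) (e : rel X) (i : nat) : {poly R} :=
  match i with
  | 0 => 1
  | 1 => (cnum e 1)%:R^-1 *: 'X
  | (j.+1 as h).+1 =>
      (cnum e i)%:R^-1 *: ('X * fpoly R e h - (bnum e j)%:R *: fpoly R e j)
  end.

(* p_i = f_i + f_{i-2} + f_{i-4} + ... *)
Definition ppoly (R : realType) (X : finType) (e : rel X) (i : nat) : {poly R} :=
  \sum_(j < i.+1 | odd j == odd i) fpoly R e j.

(* P_i; see ppolyE. *)
Definition Ppoly (R : realType) (X : finType) (e : rel X) (i : nat) : {poly R} :=
  if odd i then odd_poly (ppoly R e i) else even_poly (ppoly R e i).

Lemma fpoly_parity (R : realType) (X : finType) (e : rel X) (i j : nat) :
  odd j != odd i -> (fpoly R e i)`_j = 0.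
Proof.
have [m] := ubnP i; elim: m i j => // m IH [|[|i]] j; rewrite ltnS => lim hj.
- by rewrite coef1; case: j hj.
- by rewrite coefZ coefX; case: j hj => [|[|j]] //= _; rewrite mulr0.
- rewrite [fpoly R e _]/= coefZ coefB coefZ coefXM.
  rewrite -/(fpoly R e i.+1).
  rewrite (IH i) ?(ltnW lim) //; last by move: hj; rewrite /= negbK.
  case: j hj => [|j] hj; first by rewrite mulr0 subr0 mulr0.
  rewrite [j.+1.-1]/= (IH i.+1) ?mulr0 ?subr0 ?mulr0 //.
  by move: hj => /=; case: (odd j); case: (odd i).
Qed.

Lemma ppolyE (R : realType) (X : finType) (e : rel X) (i : nat) :
  ppoly R e i = if odd i then 'X * (Ppoly R e i \Po 'X^2)
                else Ppoly R e i \Po 'X^2.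
Proof.
have par j : odd j != odd i -> (ppoly R e i)`_j = 0.
  move=> hj; rewrite coef_sum big1 // => h /eqP hh.
  by apply: fpoly_parity; rewrite hh.
rewrite /Ppoly; case: (boolP (odd i)) => oi; apply/polyP => j.
- rewrite coefXM coef_comp_poly_Xn //.
  case: j => [|j] /=; first by rewrite par // oi.
  rewrite dvdn2; case: (boolP (odd j)) => oj /=.
    by rewrite par // oi /= oj.
  by rewrite coef_odd_poly divn2 even_halfK.
- rewrite coef_comp_poly_Xn //.
  rewrite dvdn2; case: (boolP (odd j)) => oj /=.
    by rewrite par // oj (negbTE oi).
  by rewrite coef_even_poly divn2 even_halfK.
Qed.

(* Main.v *)
Require Import Defs.
From mathcomp Require Import all_boot all_order all_algebra.
From mathcomp Require Import reals complex spectral.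
From mathcomp Require Import zify ring lra.

Set Implicit Arguments.
Unset Strict Implicit.
Unset Printing Implicit Defensive.

Import Order.TTheory GRing.Theory Num.Theory.
Local Open Scope ring_scope.
Local Open Scope complex_scope.

Local Arguments cnum : simpl never.

(* Write A for the adjacency matrix, A_i for the distance matrices, E_i for the
   dual idempotents and w_i = E_(i+2) A_i v.  Since W has endpoint 2, v is
   orthogonal to the all-ones vector, so E_(i+2) (A_i + A_(i+2) + A_(i+4)) v = 0;
   by thinness the last two summands are (a_i - 1) w_i and - a_i w_i, and
   E_(i+2) A w_(i+1) = n_i w_i.  Comparing components in the three-term
   recurrence for A A_j v gives
     n_i = b_(i+2) + c_(i+2) a_i - c_i a_(i-1),    a_(i+1) n_i = b_(i+4) a_i,
   with a_0 = 1 + eta, and n_i |w_i|^2 = c_(i+1) |w_(i+1)|^2 because A is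
   symmetric.  The recurrence c_(i+1) p_(i+1) + b_(i+1) p_(i-1) = x p_i solves
   this system in closed form, and P_i(psi) <> 0 drops out of n_i <> 0.

   It remains to see that w_i <> 0 for i <= D - 2.  As long as the previous
   vectors do not vanish, w_i = q(A) v for a polynomial q of degree i, and for
   every polynomial q
     |X| |q(A) v|^2 / |v|^2 = tr (|q|^2(A) s(A)),
     s(t) = (k^2 - t^2) (1 + (1 + eta) (t^2 - b_2) / (b_2 b_3)) / (k b_1).
   The hypothesis on eta says that s is positive at theta_1, ..., theta_(D-1)
   (it vanishes at k and - k), using theta_d^2 < b_2 < theta_1^2, which follows
   from tr ((k^2 - A^2) (A^2 - b_2)) = 0.  Hence q(A) v = 0 forces q = 0 when
   deg q <= D - 2. *)

(** * Distance-regular graphs *)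

Section Distance.
Context (X : finType) (e : rel X).
Hypotheses (e_sym : symmetric e) (e_conn : forall y z, connect e y z).
Local Notation d := (gdist e).
Implicit Types y z t : X.

Lemma walkP n y z :
  reflect (exists p, [/\ size p = n, path e y p & last y p = z]) (walk e n y z).
Proof.
apply: (iffP existsP) => [[p /andP[ep /eqP lp]]|[p [sp ep lp]]].
  by exists p; rewrite size_tuple.
by exists (tcast sp (in_tuple p)); rewrite val_tcast /= ep lp /=.
Qed.

Lemma walk_cat m n y z t : walk e m y z -> walk e n z t -> walk e (m + n) y t.
Proof.
move=> /walkP[p [sp ep lp]] /walkP[q [sq eq lq]]; apply/walkP.
by exists (p ++ q); rewrite size_cat sp sq cat_path last_cat ep lp.
Qed.

Lemma walk_sym n y z : walk e n y z -> walk e n z y.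
Proof.
move=> /walkP[p [sp ep lp]]; apply/walkP.
exists (rev (belast y p)); split; first by rewrite size_rev size_belast.
  by rewrite -lp rev_path; under eq_path do rewrite e_sym.
by rewrite -lp; case: p {sp ep lp} => //= t p; rewrite rev_cons last_rcons.
Qed.

Lemma gdist_le n y z : walk e n y z -> (d y z <= n)%N.
Proof.
(* [find] returns at most the length [#|X|] of the searched list, so the walk matters only for
   [n < #|X|]. *)
move=> w; have [ltn|le] := ltnP n #|X|; last first.
  by apply: leq_trans le; rewrite -[leqRHS](size_iota 0) find_size.
rewrite leqNgt; apply/negP => /(before_find 0%N).
by rewrite nth_iota // add0n w.
Qed.

(** A path without repeated vertices has length below [#|X|], so the bounded search succeeds. *)
Lemma gdist_walk y z : walk e (d y z) y z.
Proof.
have hw : has (fun n => walk e n y z) (iota 0 #|X|).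
  have /connectP[p ep ->] := e_conn y z.
  case/shortenP: ep => q eq uq _; apply/hasP; exists (size q); last first.
    by apply/walkP; exists q.
  by rewrite mem_iota add0n /=; have := max_card (mem (y :: q)); rewrite (card_uniqP uq).
have := nth_find 0%N hw; rewrite nth_iota //.
by move: hw; rewrite has_find size_iota.
Qed.

Lemma gdist_sym y z : d y z = d z y.
Proof. by apply/eqP; rewrite eqn_leq !gdist_le // walk_sym // gdist_walk. Qed.

Lemma gdist_triangle y z t : (d y t <= d y z + d z t)%N.
Proof. by apply/gdist_le/walk_cat/gdist_walk/gdist_walk. Qed.

Lemma gdistxx y : d y y = 0%N.
Proof. by apply/eqP; rewrite -leqn0 gdist_le //; apply/walkP; exists [::]. Qed.

Lemma gdist_eq0 y z : (d y z == 0%N) = (y == z).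
Proof.
apply/eqP/eqP => [d0|->]; last exact: gdistxx.
by have := gdist_walk y z; rewrite d0 => /walkP[[|? ?] []].
Qed.

Lemma gdist_edge y z : e y z -> (d y z <= 1)%N.
Proof. by move=> eyz; apply/gdist_le/walkP; exists [:: z]; rewrite /= eyz. Qed.

Lemma gdist_eq1 (e_irr : irreflexive e) y z : (d y z == 1%N) = e y z.
Proof.
apply/eqP/idP => [d1|eyz].
  have := gdist_walk y z; rewrite d1 => /walkP[[|t [|? ?]] []] //= _.
  by rewrite andbT => eyt <-.
apply/eqP; rewrite eqn_leq gdist_edge // lt0n gdist_eq0.
by apply: contraTN eyz => /eqP ->; rewrite e_irr.
Qed.

Lemma gdist_step n y z : d y z = n.+1 -> exists2 t, e y t & d t z = n.
Proof.
move=> dn; have := gdist_walk y z; rewrite dn => /walkP[[|t p] []] //= [sp].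
case/andP=> eyt ep lp; exists t => //; apply/eqP; rewrite eqn_leq.
rewrite gdist_le; last by apply/walkP; exists p.
by have := gdist_triangle y t z; have := gdist_edge eyt; rewrite dn; lia.
Qed.

(** Each edge switches sides, so the parity of a distance is the xor of the sides of its ends; the
    side of the middle vertex cancels. *)
Lemma gdist_parity (e_bip : bipartite e) x y z :
  odd (d x z) = odd (d x y) (+) odd (d y z).
Proof.
have [side sideP] := e_bip.
have par s t : odd (d s t) = side s (+) side t.
  have /walkP[p [<- + <-]] := gdist_walk s t.
  elim: p s => [|u p IH] s /=; first by rewrite addbb.
  case/andP=> /sideP; move=> + /IH ->.
  by case: (side s); case: (side u); case: (side _).
by rewrite !par; case: (side x); case: (side y); case: (side z).
Qed.

Lemma gdist_diameter y z : (d y z <= diameter e)%N.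
Proof. exact: (leq_bigmax (y, z)). Qed.

(** Along a geodesic between vertices at distance $D$, the distance to the end drops by one at each
    step. *)
Lemma gdist_attained (x0 : X) i : (i <= diameter e)%N -> exists y z, d y z = i.
Proof.
move=> le_i; have [|[y z]] := @bigop.eq_bigmax (X * X)%type (fun u => d u.1 u.2).
  by apply/card_gt0P; exists (x0, x0).
rewrite -/(diameter e) /= => dm.
have : (i <= d y z)%N by rewrite -dm.
suff IH n t : d t z = n -> (i <= n)%N -> exists y z, d y z = i by apply: IH.
elim: n t => [|n IH] t dt; rewrite leq_eqVlt => /predU1P[->|] //; first by exists t, z.
  by exists t, z.
by have [u _ /IH] := gdist_step dt; rewrite ltnS.
Qed.

End Distance.

Section IntersectionNumbers.
Context (X : finType) (e : rel X) (k : nat).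
Hypotheses (e_drg : bipartite_drg e) (e_val : forall y, #|[set z | e y z]| = k).
Local Notation d := (gdist e).
Local Notation D := (diameter e).
Local Notation b := (bnum e).
Local Notation c := (cnum e).

Let e_sym : symmetric e. Proof. by case: e_drg. Qed.
Let e_irr : irreflexive e. Proof. by case: e_drg. Qed.
Let e_conn y z : connect e y z. Proof. by case: e_drg. Qed.
Let e_bip : bipartite e. Proof. by case: e_drg. Qed.

Lemma inter_numE i j y z :
  inter_num e (d y z) i j = sphere_meet e i j y z.
Proof.
have [_ _ _ _ reg] := e_drg; rewrite /inter_num.
case: pickP => [[s t] /eqP /= dst|/(_ (y, z))]; last by rewrite /= eqxx.
exact: reg dst _.
Qed.

Lemma bnum_card y z : b (d y z) = #|[set t | e y t && (d t z == (d y z).+1)]|.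
Proof.
rewrite [LHS]inter_numE; apply: eq_card => t.
by rewrite !inE (gdist_eq1 e_conn).
Qed.

Lemma cnum_card y z :
  c (d y z) = #|[set t | e y t && ((d t z).+1 == d y z)]|.
Proof.
rewrite /cnum; case dyz: (d y z) => [|h].
  by rewrite eq_card0 // => t; rewrite !inE andbF.
rewrite -dyz [LHS]inter_numE; apply: eq_card => t.
by rewrite !inE (gdist_eq1 e_conn) // dyz.
Qed.

Lemma gdist_neighbour y z t : e y t -> d t z = (d y z).+1 \/ (d t z).+1 = d y z.
Proof.
move=> eyt; have := gdist_triangle e_conn y t z.
have := gdist_triangle e_conn t y z.
have := gdist_parity e_conn e_bip y t z.
have /eqP -> : d t y == 1%N by rewrite (gdist_eq1 e_conn) // e_sym.
have /eqP -> : d y t == 1%N by rewrite (gdist_eq1 e_conn).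
rewrite addTb add1n => par le1 le2.
have [lt|lt|eq] := ltngtP (d t z) (d y z); first by right; lia.
  by left; lia.
by move: par; rewrite eq; case: odd.
Qed.

(** Neighbours split into [c] closer and [b] farther ones; all three-term recurrences come from
    here. At distance 0 the default index [0.-1] carries the factor [c 0 = 0]. *)
Lemma sum_neighbours (V : nmodType) (f : nat -> V) y z :
  \sum_(t | e y t) f (d t z)
  = f (d y z).-1 *+ c (d y z) + f (d y z).+1 *+ b (d y z).
Proof.
rewrite (bigID (fun t => (d t z).+1 == d y z)) /=; congr (_ + _).
  rewrite cnum_card -sumr_const; apply: eq_big => [t|t /andP[_ /eqP <-] //].
  by rewrite inE.
rewrite bnum_card -sumr_const; apply: eq_big => [t|t /andP[/(gdist_neighbour z)]].
  rewrite inE; apply: andb_id2l => /(gdist_neighbour z) []; lia.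
by move=> [->//|->]; rewrite eqxx.
Qed.

Lemma bnumDcnum (x0 : X) i : (i <= D)%N -> (b i + c i = k)%N.
Proof.
case/(gdist_attained e_conn x0) => y [z <-].
rewrite -(e_val y) -sum1_card; under eq_bigl do rewrite inE.
rewrite (sum_neighbours (fun=> 1%N : nat) y z) addrC.
by rewrite !natn.
Qed.

Lemma bnum_gt0 (x0 : X) i : (i < D)%N -> (0 < b i)%N.
Proof.
case/(gdist_attained e_conn x0) => y [z dyz].
have [t eyt dtz] := gdist_step e_conn dyz; rewrite -dtz bnum_card.
by apply/card_gt0P; exists y; rewrite inE e_sym eyt dtz dyz eqxx.
Qed.

Lemma cnum_gt0 (x0 : X) i : (0 < i <= D)%N -> (0 < c i)%N.
Proof.
case: i => // i /(gdist_attained e_conn x0) [y [z dyz]].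
have [t eyt dtz] := gdist_step e_conn dyz; rewrite -dyz cnum_card.
by apply/card_gt0P; exists t; rewrite inE eyt dtz dyz eqxx.
Qed.

Lemma bnum0 (x0 : X) : b 0 = k.
Proof. by rewrite -(@bnumDcnum x0 0) // addn0. Qed.

Lemma cnum1 (x0 : X) : (0 < D)%N -> c 1 = 1%N.
Proof.
case/(gdist_attained e_conn x0) => y [z dyz]; rewrite -dyz cnum_card dyz.
rewrite -[RHS](cards1 z); apply: eq_card => t; rewrite !inE eqSS.
rewrite (gdist_eq0 e_conn) andb_idl // => /eqP ->.
by rewrite -(gdist_eq1 e_conn) // dyz.
Qed.

End IntersectionNumbers.

(** * The Bose-Mesner algebra in the basis of distance matrices *)

Section DistanceMatrices.
Context (F : comNzRingType) (X : finType) (e : rel X) (k : nat).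
Hypotheses (e_drg : bipartite_drg e) (e_val : forall y, #|[set z | e y z]| = k).
Local Notation d := (gdist e).
Local Notation D := (diameter e).
Local Notation b := (bnum e).
Local Notation c := (cnum e).
Local Notation A := (dist_mx F e 1).

Let e_sym : symmetric e. Proof. by case: e_drg. Qed.
Let e_irr : irreflexive e. Proof. by case: e_drg. Qed.
Let e_conn y z : connect e y z. Proof. by case: e_drg. Qed.
Let e_bip : bipartite e. Proof. by case: e_drg. Qed.

(* The elements of the Bose-Mesner algebra, given by their entries; they are
   multiplied by A according to the three-term recurrence [adj_coef]. *)
Definition bm_mx (f : nat -> F) : 'M[F]_#|X| :=
  \matrix_(y, z) f (d (enum_val y) (enum_val z)).

Definition adj_coef (f : nat -> F) (h : nat) : F :=
  (c h)%:R * f h.-1 + (b h)%:R * f h.+1.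

Lemma sum_enum_val (V : nmodType) (f : X -> V) :
  \sum_(y < #|X|) f (enum_val y) = \sum_y f y.
Proof. by rewrite [RHS](big_enum_val (A := X)). Qed.

Lemma dist_mxE i : dist_mx F e i = bm_mx (fun h => (h == i)%:R).
Proof. by []. Qed.

Lemma dist_mx0 : dist_mx F e 0 = 1%:M.
Proof.
by apply/matrixP => y z; rewrite !mxE (gdist_eq0 e_conn) (inj_eq enum_val_inj).
Qed.

Lemma adj_mul_bm f : A *m bm_mx f = bm_mx (adj_coef f).
Proof.
apply/matrixP => y z; rewrite !mxE /adj_coef !mulr_natl -(sum_neighbours e_drg).
under eq_bigr do rewrite !mxE.
rewrite (sum_enum_val (fun t => (d (enum_val y) t == 1%N)%:R *
  f (d t (enum_val z)))) [RHS]big_mkcond; apply: eq_bigr => t _.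
by rewrite (gdist_eq1 e_conn) //; case: e; rewrite ?mul1r ?mul0r.
Qed.

Lemma adj_mul_dist i :
  A *m dist_mx F e i.+1 =
    (b i)%:R *: dist_mx F e i + (c i.+2)%:R *: dist_mx F e i.+2.
Proof.
rewrite [dist_mx F e i.+1]dist_mxE adj_mul_bm; apply/matrixP => y z; rewrite !mxE /adj_coef.
case: (d _ _) => [|h] /=.
  by case: i => [|i]; rewrite ?mul0r ?mulr0 ?add0r ?addr0.
rewrite !eqSS addrC; case: eqVneq => [<-|_]; rewrite ?mulr0;
  by case: eqVneq => [->|_]; rewrite ?mulr0.
Qed.

Lemma scale_bm a f : a *: bm_mx f = bm_mx (fun h => a * f h).
Proof. by apply/matrixP => y z; rewrite !mxE. Qed.

Lemma sub_bm f g : bm_mx f - bm_mx g = bm_mx (fun h => f h - g h).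
Proof. by apply/matrixP => y z; rewrite !mxE. Qed.

Lemma tr_bm f : \tr (bm_mx f) = #|X|%:R * f 0%N.
Proof.
rewrite /mxtrace; under eq_bigr do rewrite mxE gdistxx.
by rewrite sumr_const card_ord mulr_natl.
Qed.

Lemma trmx_bm f : (bm_mx f)^T = bm_mx f.
Proof. by apply/matrixP => y z; rewrite !mxE (gdist_sym e_sym). Qed.

Lemma dist_mx_big i : (D < i)%N -> dist_mx F e i = 0.
Proof.
move=> lt_D; apply/matrixP => y z; rewrite !mxE.
by have := gdist_diameter e (enum_val y) (enum_val z); case: eqP => // ->; lia.
Qed.

Lemma sum_dist_mx : \sum_(i < D.+1) dist_mx F e i = const_mx 1.
Proof.
apply/matrixP => y z; rewrite summxE mxE.
have lt_D := gdist_diameter e (enum_val y) (enum_val z); rewrite -ltnS in lt_D.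
rewrite (bigD1 (Ordinal lt_D)) //= mxE eqxx big1 ?addr0 // => j.
by rewrite mxE -val_eqE eq_sym /= => /negbTE ->.
Qed.

End DistanceMatrices.
Arguments bm_mx {F X} e f.

(** * Two trace identities in the Bose-Mesner algebra *)

Section BoseMesnerTrace.
Context (F : comNzRingType) (X : finType) (e : rel X) (k : nat) (x0 : X).
Hypotheses (e_drg : bipartite_drg e) (e_val : forall y, #|[set z | e y z]| = k).
Hypothesis D_ge4 : (4 <= diameter e)%N.
Local Notation b i := ((bnum e i)%:R : F).
Local Notation c i := ((cnum e i)%:R : F).
Local Notation k' := (k%:R : F).
Local Notation A := (dist_mx F e 1).

Let bck i : (i <= 4)%N -> k' = b i + c i.
Proof.
by move=> le4; rewrite -natrD (bnumDcnum e_drg e_val x0) // (leq_trans le4).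
Qed.

Let c0 : c 0 = 0. Proof. by []. Qed.

(** The trace reads off the coefficient at distance 0, and $k^2 - k = k b_1$. *)
Lemma tr_bm_quad (f : nat -> F) :
  \tr (k' ^+ 2 *: bm_mx e f - A *m (A *m bm_mx e f))
  = #|X|%:R * (k' * b 1 * (f 0%N - f 2%N)).
Proof.
rewrite !(adj_mul_bm e_drg) scale_bm sub_bm tr_bm /adj_coef /=.
have := bck (isT : 1 <= 4)%N; have := bck (isT : 0 <= 4)%N.
rewrite (cnum1 e_drg x0); last by lia.
rewrite !(bnum0 e_drg e_val x0) c0 => _ hk.
move: (c 1) (b 1) (k%:R) (#|X|%:R) hk => c1 b1 kk x hk.
by rewrite hk; ring.
Qed.

(** This is the previous identity for the coefficients of $(A^2 - b_2)M$. The shift by $b_2$ makes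
    [f 0] cancel: its coefficient is $k - b_2$ at distance 0 and $c_2$ at distance 2, which
    agree. *)
Lemma tr_bm_quartic (f : nat -> F) :
  let N := A *m (A *m bm_mx e f) - b 2 *: bm_mx e f in
  \tr (k' ^+ 2 *: N - A *m (A *m N))
  = #|X|%:R * (k' * b 1 * b 2 * b 3 * (f 2%N - f 4%N)).
Proof.
rewrite /= [A *m (A *m bm_mx e f)](_ : _ = bm_mx e (adj_coef e (adj_coef e f))); last first.
  by rewrite !(adj_mul_bm e_drg).
rewrite scale_bm sub_bm tr_bm_quad /adj_coef /=; congr (_ * _).
have := bck (isT : 1 <= 4)%N; have := bck (isT : 2 <= 4)%N.
have := bck (isT : 3 <= 4)%N.
rewrite (cnum1 e_drg x0); last by lia.
rewrite (bnum0 e_drg e_val x0) c0 => h3 h2 h1.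
move: (c 2) (c 3) (b 1) (b 2) (b 3) k' h1 h2 h3 => c2 c3 b1 b2 b3 kk h1 h2 h3.
have -> : c3 = kk - b3 by rewrite h3; ring.
have -> : c2 = kk - b2 by rewrite h2; ring.
have -> : b1 = kk - 1 by rewrite h1; ring.
ring.
Qed.
End BoseMesnerTrace.

(** * The spectrum *)

Section SpectralCalculus.
Local Open Scope sesquilinear_scope.
Context (R : realType) (n : nat).
Local Notation C := R[i].

(** Here [h] is indexed by the rows of [P], which are eigenvectors, and not by the eigenvalues; the
    functional calculus thus becomes pointwise arithmetic on [h]. *)
Definition spec_mx (P : 'M[C]_n) (h : 'I_n -> C) : 'M[C]_n :=
  P^t* *m diag_mx (\row_j h j) *m P.

Definition spectral_decomposition (A : 'M[R]_n) (P : 'M[C]_n)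
    (r : 'I_n -> R) : Prop :=
  P \is unitarymx /\ map_mx (real_complex R) A = spec_mx P (fun j => (r j)%:C).

Lemma symmetric_spectral (A : 'M[R]_n) : A^T = A ->
  exists P r, spectral_decomposition A P r.
Proof.
move=> symA; pose B := map_mx (real_complex R) A.
have hB : B \is hermsymmx.
  apply: realsym_hermsym.
    by apply/is_hermitianmxP; rewrite expr0 scale1r map_mx_id // /B map_trmx symA.
  by apply/mxOverP => i j; rewrite mxE complex_real.
have /mxOverP rB := hermitian_spectral_diag_real hB.
exists (spectralmx B), (fun j => complex.Re (spectral_diag B 0 j)).
split; first exact: spectral_unitarymx.
rewrite -/B {1}(orthomx_spectralP (hermitian_normalmx hB)).
rewrite invmx_unitary ?spectral_unitarymx // /spec_mx.
by congr (_ *m diag_mx _ *m _); apply/rowP => j; rewrite mxE RRe_real.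
Qed.

Context (P : 'M[C]_n) (uP : P \is unitarymx).
Implicit Types g h : 'I_n -> C.

Lemma unitary_mulVmx : P^t* *m P = 1%:M.
Proof. by rewrite -invmx_unitary // mulVmx // unitarymx_unit. Qed.

Lemma spec_mul g h : spec_mx P g *m spec_mx P h = spec_mx P (fun j => g j * h j).
Proof.
rewrite /spec_mx !mulmxA -[_ *m P *m P^t*]mulmxA (unitarymxP uP) mulmx1.
rewrite -[_ *m diag_mx _ *m diag_mx _]mulmxA mulmx_diag.
by congr (_ *m diag_mx _ *m _); apply/rowP => j; rewrite !mxE.
Qed.

Lemma spec_sub g h : spec_mx P g - spec_mx P h = spec_mx P (fun j => g j - h j).
Proof.
rewrite /spec_mx -mulmxBl -mulmxBr -linearB /=.
by congr (_ *m diag_mx _ *m _); apply/rowP => j; rewrite !mxE.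
Qed.

Lemma spec_add g h : spec_mx P g + spec_mx P h = spec_mx P (fun j => g j + h j).
Proof.
rewrite /spec_mx -mulmxDl -mulmxDr -linearD /=.
by congr (_ *m diag_mx _ *m _); apply/rowP => j; rewrite !mxE.
Qed.

Lemma spec_scale a h : a *: spec_mx P h = spec_mx P (fun j => a * h j).
Proof.
rewrite /spec_mx scalemxAl scalemxAr -linearZ /=.
by congr (_ *m diag_mx _ *m _); apply/rowP => j; rewrite !mxE.
Qed.

Lemma spec_const a : spec_mx P (fun=> a) = a%:M.
Proof.
rewrite -[RHS]mulmx1 -unitary_mulVmx mulmxA -scalar_mxC /spec_mx.
by congr (_ *m _ *m _); apply/matrixP => i j; rewrite !mxE.
Qed.

Lemma spec_adj h : (spec_mx P h)^t* = spec_mx P (fun j => (h j)^*).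
Proof.
rewrite /spec_mx !trmx_mul !map_mxM /= trmxCK mulmxA tr_diag_mx map_diag_mx.
by congr (_ *m diag_mx _ *m _); apply/rowP => j; rewrite !mxE.
Qed.

Lemma spec_tr h : \tr (spec_mx P h) = \sum_j h j.
Proof.
rewrite /spec_mx mxtrace_mulC mulmxA (unitarymxP uP) mul1mx mxtrace_diag.
by apply: eq_bigr => j _; rewrite mxE.
Qed.

Lemma eq_spec g h : g =1 h -> spec_mx P g = spec_mx P h.
Proof.
by move=> gh; congr (_ *m diag_mx _ *m _); apply/rowP => j; rewrite !mxE.
Qed.

End SpectralCalculus.

Section Eigenvalues.
Local Open Scope sesquilinear_scope.
Context (R : realType) (n : nat) (A : 'M[R]_n) (P : 'M[R[i]]_n) (r : 'I_n -> R).
Hypothesis dec : spectral_decomposition A P r.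

(** In the basis given by [P] an eigenvector becomes one of a diagonal matrix, and a nonzero
    coordinate [j] forces [a = r j]; conversely the rows of [P] are eigenvectors. *)
Lemma spectral_eigenvalue a : eigenvalue A a <-> exists j, r j = a.
Proof.
have [uP defA] := dec; have PV := unitary_mulVmx uP.
rewrite -(eigenvalue_map (real_complex R)) defA; split.
  case/eigenvalueP => u uA u0; pose w := u *m P^t*.
  have w0 : w != 0.
    by apply: contraNneq u0 => w0; rewrite -[u]mulmx1 -PV mulmxA -/w w0 mul0mx.
  have wD : w *m diag_mx (\row_j (r j)%:C) = a%:C *: w.
    rewrite /w scalemxAl -uA /spec_mx !mulmxA.
    by rewrite -[_ *m P *m P^t*]mulmxA (unitarymxP uP) mulmx1.
  clearbody w; have [j wj] := rV0Pn _ w0; exists j; apply: complexI.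
  apply: (mulfI wj); move/rowP/(_ j): wD.
  by rewrite mul_mx_diag !mxE [_%:C * _]mulrC.
case=> j <-; apply/eigenvalueP; exists (row j P).
  rewrite /spec_mx !mulmxA -row_mul (unitarymxP uP) row1.
  by rewrite -rowE row_diag_mx -scalemxAl -rowE mxE.
apply: contraTneq isT => Pj0; have := unitarymxP uP.
move/(congr1 (row j)); rewrite row_mul Pj0 mul0mx => /rowP /(_ j).
by rewrite !mxE eqxx => /esym /eqP; rewrite oner_eq0.
Qed.
End Eigenvalues.

(** Reversing and negating [s] gives a strictly decreasing sequence with the same elements, hence
    [s] itself. *)
Lemma symmetric_decreasing (R : realDomainType) (s : seq R) m i :
  sorted >%R s -> size s = m.+1 -> (forall a, a \in s -> - a \in s) ->
  (i <= m)%N -> s`_(m - i) = - s`_i.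
Proof.
move=> sorted_s size_s opp_s le_im.
have gtrans : transitive (>%R : rel R) by apply: rev_trans; apply: lt_trans.
have -> : s`_i = (map -%R (rev s))`_i.
  congr nth; apply: (irr_sorted_eq gtrans) => //; first exact: ltxx.
    rewrite sorted_map rev_sorted; apply: sub_sorted sorted_s => a b /=.
    by rewrite ltrN2.
  move=> a; apply/idP/mapP => [/opp_s|[b + ->]].
    by exists (- a); rewrite ?mem_rev ?opprK.
  by rewrite mem_rev => /opp_s.
rewrite (nth_map 0) ?size_rev ?size_s // nth_rev ?size_s // opprK.
by rewrite subSS.
Qed.

(** The reflection $s_{m-i} = -s_i$ bounds $|s_i|$ above by $s_1$, and below by the middle term
    $s_{\lfloor m/2\rfloor}$, which is nonnegative. *)
Lemma symmetric_decreasing_bounds (R : realDomainType) (s : seq R) m k i :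
  sorted >%R s -> size s = m.+1 -> (forall a, a \in s -> - a \in s) ->
  k \in s -> (forall a, a \in s -> a <= k) -> (0 < i < m)%N ->
  (s`_(m./2) ^+ 2 <= s`_i ^+ 2) && (s`_i ^+ 2 <= s`_1 ^+ 2 < k ^+ 2).
Proof.
move=> sorted_s size_s opp_s ks le_k /andP[i0 lt_im].
have anti j l : (j <= l <= m)%N -> s`_l <= s`_j.
  case/andP; rewrite leq_eqVlt => /predU1P[->//|jl lm]; apply: ltW.
  by apply: (sorted_ltn_nth _ 0 sorted_s) => //; rewrite ?inE ?size_s; try lia;
    apply: rev_trans; apply: lt_trans.
have refl j := symmetric_decreasing (i := j) sorted_s size_s opp_s.
have s0k : s`_0 = k.
  apply/eqP; rewrite eq_le le_k ?mem_nth ?size_s //=.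
  by have := ks => /(nthP 0) [j + <-]; rewrite size_s => jm; apply: anti; lia.
have s1k : s`_1 < k.
  rewrite -s0k; apply: (sorted_ltn_nth _ 0 sorted_s) => //; rewrite ?inE ?size_s; try lia.
  by apply: rev_trans; apply: lt_trans.
have s1_ge0 : 0 <= s`_1.
  have := anti 1%N (m - 1)%N; rewrite refl; last by lia.
  have h : (1 <= m - 1 <= m)%N by lia.
  by move/(_ h); lra.
have d_ge0 : 0 <= s`_(m./2).
  have := anti m./2 (m - m./2)%N; rewrite refl; last by lia.
  have h : (m./2 <= m - m./2 <= m)%N by lia.
  by move/(_ h); lra.
have le1 : s`_i <= s`_1 by apply: anti; lia.
have ge1 : - s`_1 <= s`_i by rewrite -refl; last lia; apply: anti; lia.
apply/andP; split; last by apply/andP; split; nra.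
have [le_i|lt_i] := leqP i m./2.
  have : s`_(m./2) <= s`_i by apply: anti; lia.
  nra.
have : s`_(m./2) <= - s`_i by rewrite -refl; last lia; apply: anti; lia.
nra.
Qed.

(** * Symmetry and extent of the spectrum of the graph *)

Section Spectrum.
Context (R : realType) (X : finType) (e : rel X) (k : nat) (x0 : X).
Hypotheses (e_drg : bipartite_drg e) (e_val : forall y, #|[set z | e y z]| = k).
Local Notation A := (dist_mx R e 1).

Let e_sym : symmetric e. Proof. by case: e_drg. Qed.
Let e_irr : irreflexive e. Proof. by case: e_drg. Qed.
Let e_conn y z : connect e y z. Proof. by case: e_drg. Qed.

Lemma adj_mxE y z : A y z = (e (enum_val y) (enum_val z))%:R.
Proof. by rewrite mxE (gdist_eq1 e_conn). Qed.

Lemma adj_row_sum y : \sum_z A z y = k%:R.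
Proof.
under eq_bigr do rewrite adj_mxE e_sym.
rewrite (sum_enum_val (fun z => (e (enum_val y) z)%:R)) -natr_sum; congr _%:R.
rewrite -(e_val (enum_val y)) -sum1dep_card [RHS]big_mkcond.
by apply: eq_bigr => z _; case: e.
Qed.

Lemma eigenvalue_valency : eigenvalue A k%:R.
Proof.
apply/eigenvalueP; exists (const_mx 1).
  apply/rowP => y; rewrite !mxE mulr1 -(adj_row_sum y).
  by apply: eq_bigr => z _; rewrite !mxE mul1r.
apply/eqP => /rowP /(_ (enum_rank x0)); rewrite !mxE => /eqP.
by rewrite oner_eq0.
Qed.

(** Changing the sign of an eigenvector on one side of the bipartition negates its eigenvalue. *)
Lemma eigenvalue_opp a : eigenvalue A a -> eigenvalue A (- a).
Proof.
have [_ _ _ [side sideP] _] := e_drg.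
case/eigenvalueP => u uA u0; apply/eigenvalueP.
pose w := \row_y ((-1) ^+ side (enum_val y) * u 0 y) : 'rV_#|X|.
exists w; last first.
  apply: contraNneq u0 => /rowP w0; apply/eqP/rowP => y.
  by have /eqP := w0 y; rewrite !mxE mulf_eq0 signr_eq0 => /eqP.
apply/rowP => y; move/rowP/(_ y): uA; rewrite !mxE => uA.
set s := (X in _ * (X * _)); rewrite [RHS](_ : _ = - (s * (a * u 0 y))); last by ring.
rewrite -uA big_distrr -sumrN /=; apply: eq_bigr => z _.
rewrite !adj_mxE mxE; case: (boolP (e _ _)) => [/sideP|_]; last first.
  by rewrite !mulr0 oppr0.
by rewrite /s; case: (side _); case: (side _) => //= _; rewrite ?expr0 ?expr1; ring.
Qed.

(** Compare the sums of absolute values of the entries of $uA$ and $u$: as [A] has constant row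
    sums, the former is at most $k$ times the latter. *)
Lemma eigenvalue_le a : eigenvalue A a -> a <= k%:R.
Proof.
case/eigenvalueP => u uA u0.
have [y uy] := rV0Pn _ u0.
have S0 : 0 < \sum_z `|u 0 z|.
  by rewrite (bigD1 y) //= ltr_pwDl ?normr_gt0 ?sumr_ge0.
apply: le_trans (ler_norm a) _; rewrite -(ler_pM2r S0) mulr_sumr.
under eq_bigr => z _.
  rewrite -normrM (_ : a * u 0 z = (u *m A) 0 z); last by rewrite uA mxE.
  over.
rewrite mulr_sumr; under [leRHS]eq_bigr => z _ do
  rewrite -(adj_row_sum z) mulr_suml.
rewrite exchange_big; apply: ler_sum => z _; rewrite mxE.
apply: le_trans (ler_norm_sum _ _ _) _; apply: ler_sum => t _.
rewrite normrM mulrC ler_wpM2r // !adj_mxE normr_nat e_sym //.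
Qed.

End Spectrum.

(** * Positivity of the spectral weight determined by the local eigenvalue *)

Section LocalPositivity.
Context (R : realType) (X : finType) (e : rel X) (k : nat) (x0 : X).
Hypotheses (e_drg : bipartite_drg e) (e_val : forall y, #|[set z | e y z]| = k).
Local Notation C := R[i].
Local Notation D := (diameter e).
Hypothesis D_ge4 : (4 <= D)%N.
Context (P : 'M[C]_#|X|) (r : 'I_#|X| -> R).
Hypothesis dec : spectral_decomposition (dist_mx R e 1) P r.
Context (theta : seq R).
Hypotheses (size_theta : size theta = D.+1) (e_theta : graph_eigenvalues e theta).
Local Notation b i := ((bnum e i)%:R : R).
Local Notation c i := ((cnum e i)%:R : R).

Lemma dist_mx_complex i : dist_mx C e i = map_mx (real_complex R) (dist_mx R e i).
Proof. by apply/matrixP => y z; rewrite !mxE rmorph_nat. Qed.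

Lemma adj_spec h :
  dist_mx C e 1 *m spec_mx P h = spec_mx P (fun j => (r j)%:C * h j).
Proof. by have [uP] := dec; rewrite dist_mx_complex => ->; rewrite spec_mul. Qed.

Lemma spec_trace_quad (f : nat -> C) h : bm_mx e f = spec_mx P h ->
  \sum_j (k%:R ^+ 2 - r j ^+ 2)%:C * h j
  = #|X|%:R * (k%:R * b 1)%:C * (f 0%N - f 2%N).
Proof.
have [uP _] := dec => fh.
have := tr_bm_quad x0 e_drg e_val D_ge4 f.
rewrite fh !adj_spec spec_scale spec_sub (spec_tr uP).
rewrite rmorphM !rmorph_nat !mulrA => <-.
apply: eq_bigr => j _; rewrite rmorphB !rmorphXn rmorph_nat /=; ring.
Qed.

Lemma spec_trace_quartic (f : nat -> C) h : bm_mx e f = spec_mx P h ->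
  \sum_j ((k%:R ^+ 2 - r j ^+ 2) * (r j ^+ 2 - b 2))%:C * h j
  = #|X|%:R * (k%:R * b 1 * b 2 * b 3)%:C * (f 2%N - f 4%N).
Proof.
have [uP _] := dec => fh.
have := tr_bm_quartic x0 e_drg e_val D_ge4 f.
rewrite /= fh !(adj_spec, spec_scale, spec_sub) (spec_tr uP).
rewrite !rmorphM !rmorph_nat !mulrA => <-.
apply: eq_bigr => j _.
rewrite rmorphM !rmorphB !rmorphXn !rmorph_nat /=; ring.
Qed.

Let theta_sorted : sorted >%R theta. Proof. by case: e_theta. Qed.
Let theta_eig a : (a \in theta) = eigenvalue (dist_mx R e 1) a.
Proof. by case: e_theta => _ ->. Qed.

Lemma theta_bounds i : (0 < i < D)%N ->
  (theta`_(D./2) ^+ 2 <= theta`_i ^+ 2)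
    && (theta`_i ^+ 2 <= theta`_1 ^+ 2 < k%:R ^+ 2).
Proof.
apply: symmetric_decreasing_bounds => //.
- by move=> a; rewrite !theta_eig; apply: eigenvalue_opp.
- by rewrite theta_eig; apply: eigenvalue_valency.
- by move=> a; rewrite theta_eig; apply: eigenvalue_le.
Qed.

Let theta_lt i j : (i < j <= D)%N -> theta`_j < theta`_i.
Proof.
case/andP=> ij jD; apply: (sorted_ltn_nth _ 0 theta_sorted);
  rewrite ?inE ?size_theta //; last by lia.
by apply: rev_trans; apply: lt_trans.
Qed.

(** Three distinct reals cannot share one square, and $D\ge 4$ puts $\theta_1,\theta_2,\theta_3$ in
    range. *)
Lemma theta_not_const a : exists2 i, (0 < i < D)%N & theta`_i ^+ 2 != a.
Proof.
have [t1|t1] := eqVneq (theta`_1 ^+ 2) a; last by exists 1%N => //; lia.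
have [t2|t2] := eqVneq (theta`_2 ^+ 2) a; last by exists 2%N => //; lia.
exists 3%N; first by lia.
have l12 : theta`_2 < theta`_1 by apply: theta_lt; lia.
have l23 : theta`_3 < theta`_2 by apply: theta_lt; lia.
rewrite -t1; apply/eqP => /eqP; rewrite eqf_sqr => /orP[] /eqP; first by lra.
by move: t1; rewrite -t2 => /eqP; rewrite eqf_sqr => /orP[] /eqP; lra.
Qed.

(* Outside [theta_1, ..., theta_(D-1)] the only eigenvalues are [k] and [-k]. *)
Lemma spectrum_cases j : r j ^+ 2 = k%:R ^+ 2 \/
  exists2 i, (0 < i < D)%N & r j = theta`_i.
Proof.
have : r j \in theta by rewrite theta_eig; apply/(spectral_eigenvalue dec); exists j.
case/(nthP 0) => i; rewrite size_theta ltnS => iD <-.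
have opp_theta a : a \in theta -> - a \in theta.
  by rewrite !theta_eig; apply: eigenvalue_opp.
have refl l := symmetric_decreasing (i := l) theta_sorted size_theta opp_theta.
have theta0 : theta`_0 = k%:R.
  apply/eqP; rewrite eq_le (eigenvalue_le e_drg e_val); last first.
    by rewrite -theta_eig mem_nth ?size_theta.
  have : k%:R \in theta by rewrite theta_eig; apply: eigenvalue_valency.
  case/(nthP 0) => [[|l]]; rewrite size_theta => lD <-; rewrite ?lexx //.
  by rewrite ltW // theta_lt.
have [->|i0] := posnP i; first by left; rewrite theta0.
have [->|iD'] := eqVneq i D; last by right; exists i => //; lia.
by left; rewrite -[D]subn0 refl // sqrrN theta0.
Qed.

Lemma theta_mem i : (i <= D)%N -> exists j, r j = theta`_i.
Proof.
by move=> iD; apply/(spectral_eigenvalue dec); rewrite -theta_eig mem_nth ?size_theta.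
Qed.

Lemma trace_zero :
  \sum_j (k%:R ^+ 2 - r j ^+ 2) * (r j ^+ 2 - b 2) = 0.
Proof.
have [uP _] := dec.
(* The quartic identity is applied to the identity matrix, whose coefficients at distances 2 and 4
   vanish. *)
have : bm_mx e (fun h => (h == 0%N)%:R : C) = spec_mx P (fun=> 1).
  by rewrite spec_const // -(dist_mx0 C e_drg).
move/spec_trace_quartic; rewrite /= subrr mulr0 => s0.
apply: complexI; rewrite rmorph_sum /= -[RHS]s0.
by apply: eq_bigr => j _; rewrite mulr1.
Qed.

(** Otherwise all terms of [trace_zero] have the same sign, hence vanish, and every $\theta_i^2$
    with $0<i<D$ equals $b_2$, against [theta_not_const]. *)
Lemma b2_between : theta`_(D./2) ^+ 2 < b 2 < theta`_1 ^+ 2.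
Proof.
(* The factor [s] is the common sign of the terms; it is 1 or -1 below. *)
have key (s : R) : (forall j, 0 <= s * ((k%:R ^+ 2 - r j ^+ 2) * (r j ^+ 2 - b 2))) ->
    s != 0 -> False.
  move=> pos s0; have := trace_zero => /(congr1 ( *%R s)); rewrite mulr_sumr mulr0.
  move/psumr_eq0P => zero; have [i i_in] := theta_not_const (b 2).
  have [j rj] := @theta_mem i ltac:(lia).
  have /eqP := zero (fun j _ => pos j) j isT.
  rewrite mulf_eq0 (negbTE s0) /= mulf_eq0 rj => /orP[]; last first.
    by rewrite subr_eq0 => /eqP ->; rewrite eqxx.
  by have /and3P[_ h1 h2] := theta_bounds i_in; rewrite subr_eq0 => /eqP; lra.
have bnd j : 0 = k%:R ^+ 2 - r j ^+ 2 \/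
    [/\ theta`_(D./2) ^+ 2 <= r j ^+ 2, r j ^+ 2 <= theta`_1 ^+ 2
      & 0 < k%:R ^+ 2 - r j ^+ 2].
  have [->|[i i_in ->]] := spectrum_cases j; first by left; rewrite subrr.
  by right; have /and3P[h1 h2 h3] := theta_bounds i_in; split=> //; lra.
apply/andP; split; rewrite ltNge; apply/negP => le_b.
  apply: (key 1) => [j|]; last exact: oner_neq0.
  by case: (bnd j) => [<-|[h1 h2 h3]]; [rewrite mul0r mulr0 | nra].
apply: (key (- 1)) => [j|]; last by rewrite oppr_eq0 oner_neq0.
by case: (bnd j) => [<-|[h1 h2 h3]]; [rewrite mul0r mulr0 | nra].
Qed.

Context (eta : R).
Hypotheses (eta1 : theta_tilde e theta`_1 < eta)
  (etad : eta < theta_tilde e theta`_(D./2)).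

(** The expression is affine in $\theta_i^2$, so the extreme values $\theta_1^2$ and $\theta_d^2$
    suffice. There it is a hypothesis on [eta] multiplied by $\theta_1^2-b_2>0$ or by
    $\theta_d^2-b_2<0$. *)
Lemma local_weight_gt0 i : (0 < i < D)%N ->
  0 < b 2 * b 3 + (1 + eta) * (theta`_i ^+ 2 - b 2).
Proof.
case/theta_bounds/and3P; move: eta1 etad; rewrite /theta_tilde.
have /andP[] := b2_between; set td := _ ^+ 2; set t1 := theta`_1 ^+ 2.
set t := theta`_i ^+ 2; move: (b 2) (b 3) => b2 b3 h1 h2 h3 h4 h5 h6 _.
have g1 : 0 < b2 * b3 + (1 + eta) * (t1 - b2).
  have t1_gt0 : 0 < t1 - b2 by lra.
  have : (- 1 - b2 * b3 * (t1 - b2)^-1) * (t1 - b2) < eta * (t1 - b2).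
    by rewrite ltr_pM2r.
  by rewrite mulrBl mulfVK ?lt0r_neq0 //; lra.
have gd : 0 < b2 * b3 + (1 + eta) * (td - b2).
  have td_lt0 : td - b2 < 0 by lra.
  have : (- 1 - b2 * b3 * (td - b2)^-1) * (td - b2) < eta * (td - b2).
    by rewrite ltr_nM2r.
  by rewrite mulrBl mulfVK ?ltr0_neq0 //; lra.
have [s|s] := lerP 0 (1 + eta); nra.
Qed.

(** Here [f] lists the coefficients of $|q|^2(A)$. If the expression vanished, so would a sum of
    nonnegative terms, and [q] would have the $D-1$ roots $\theta_1,\dots,\theta_{D-1}$, more than
    its degree allows. *)
Lemma local_nonvanishing (q : {poly C}) (f : nat -> C) :
  q != 0 -> (size q < D)%N ->
  bm_mx e f = spec_mx P (fun j => `|q.[(r j)%:C]| ^+ 2) ->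
  f 0%N + eta%:C * f 2%N - (1 + eta)%:C * f 4%N != 0.
Proof.
move=> q0 sq fq; apply/negP => /eqP f0.
(* The weight in the trace formula for $|q(A)v|^2$, with the denominator $k b_1 b_2 b_3$ cleared. *)
pose s a : R := (k%:R ^+ 2 - a ^+ 2) * (b 2 * b 3 + (1 + eta) * (a ^+ 2 - b 2)).
have s_ge0 j : 0 <= s (r j).
  rewrite /s; have [->|[i i_in ->]] := spectrum_cases j; first by rewrite subrr mul0r.
  have := local_weight_gt0 i_in; have /and3P[_ h2 h3] := theta_bounds i_in.
  by move=> h; rewrite mulr_ge0 ?(ltW h) //; lra.
pose h j := `|q.[(r j)%:C]| ^+ 2; rewrite -/h in fq.
have sum0 : \sum_j (s (r j))%:C * h j = 0.
  have tr2 := spec_trace_quad fq; have tr4 := spec_trace_quartic fq.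
  (* The weight combines those of the quadratic and quartic identities, with coefficients $b_2b_3$
     and $1+\eta$. *)
  transitivity ((b 2 * b 3)%:C * (\sum_j (k%:R ^+ 2 - r j ^+ 2)%:C * h j)
     + (1 + eta)%:C * (\sum_j ((k%:R ^+ 2 - r j ^+ 2) * (r j ^+ 2 - b 2))%:C * h j)).
    rewrite !mulr_sumr -big_split /=; apply: eq_bigr => j _.
    rewrite /s; move: (b 2) (b 3) (h j) => b2 b3 hj.
    by rewrite !(rmorphM, rmorphD, rmorphB) /=; ring.
  rewrite tr2 tr4.
  transitivity ((k%:R * b 1 * b 2 * b 3)%:C * #|X|%:R *
     (f 0%N + eta%:C * f 2%N - (1 + eta)%:C * f 4%N)); last by rewrite f0 mulr0.
  move: (b 1) (b 2) (b 3) => b1 b2 b3.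
  rewrite !rmorphM !rmorphD rmorph1 rmorph_nat /=; ring.
have term_ge0 j : 0 <= (s (r j))%:C * h j.
  by rewrite mulr_ge0 ?exprn_ge0 // lecR.
have qroot i : (0 < i < D)%N -> root q (theta`_i)%:C.
  move=> i_in; have [j rj] := @theta_mem i ltac:(lia).
  have /eqP := psumr_eq0P (fun j _ => term_ge0 j) sum0 (isT : true) (i := j).
  rewrite mulf_eq0 expf_eq0 normr_eq0 rj => /orP[|//].
  rewrite (inj_eq (@complexI R)) /s; apply: contraTT => _.
  have := local_weight_gt0 i_in; have /and3P[_ h2 h3] := theta_bounds i_in.
  by move=> w_gt0; rewrite mulf_neq0 ?lt0r_neq0 //; lra.
pose rs := [seq (theta`_i)%:C | i <- iota 1 D.-1].
have root_rs : all (root q) rs.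
  by apply/allP => _ /mapP[i i_in ->]; apply: qroot; rewrite mem_iota in i_in; lia.
have uniq_rs : uniq rs.
  rewrite map_inj_in_uniq ?iota_uniq // => i j; rewrite !mem_iota => i_in j_in.
  move=> /complexI tij; have [ij|ij|//] := ltngtP i j.
    by have := @theta_lt i j ltac:(lia); rewrite tij ltxx.
  by have := @theta_lt j i ltac:(lia); rewrite tij ltxx.
have := max_poly_roots q0 root_rs uniq_rs; rewrite size_map size_iota => lt_q.
by have := leq_ltn_trans lt_q sq; lia.
Qed.
End LocalPositivity.

(** * Thin modules with endpoint two *)

Section BoseMesnerPolynomials.
Local Open Scope sesquilinear_scope.
Context (R : realType) (X : finType) (e : rel X).
Hypothesis e_drg : bipartite_drg e.
Local Notation C := R[i].
Context (P : 'M[C]_#|X|) (r : 'I_#|X| -> R).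
Hypothesis dec : spectral_decomposition (dist_mx R e 1) P r.

Lemma bm_poly (q : {poly C}) (f : nat -> C) :
  exists g, spec_mx P (fun j => q.[(r j)%:C]) *m bm_mx e f = bm_mx e g.
Proof.
have [uP defA] := dec.
elim/poly_ind: q f => [|q a IH] f.
  exists (fun=> 0); rewrite (eq_spec P (h := fun=> 0)) => [|j]; last by rewrite horner0.
  rewrite spec_const // raddf0 mul0mx.
  by apply/matrixP => y z; rewrite !mxE.
have [g gE] := IH (adj_coef e f); exists (fun h => g h + a * f h).
rewrite (eq_spec P (h := fun j => q.[(r j)%:C] * (r j)%:C + a)); last first.
  by move=> j; rewrite hornerMXaddC.
rewrite -spec_add // -spec_mul // spec_const // mulmxDl -mulmxA -defA.
rewrite -dist_mx_complex adj_mul_bm // gE mul_scalar_mx.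
by apply/matrixP => y z; rewrite !mxE.
Qed.

Lemma adj_bm (f : nat -> C) : (bm_mx e f)^t* = bm_mx e (fun h => (f h)^*).
Proof. by rewrite trmx_bm //; apply/matrixP => y z; rewrite !mxE. Qed.

(** Write $|q|^2(A) = q(A)q(A)^*$: the adjoint factor is a [bm_mx] with conjugate coefficients, to
    which [bm_poly] applies again. *)
Lemma bm_poly_norm (q : {poly C}) :
  exists g, bm_mx e g = spec_mx P (fun j => `|q.[(r j)%:C]| ^+ 2).
Proof.
have [uP _] := dec; pose Q := spec_mx P (fun j => q.[(r j)%:C]).
have [f fE] := bm_poly q (fun h => (h == 0%N)%:R).
have QE : Q = bm_mx e f by rewrite -fE -dist_mxE (dist_mx0 C e_drg) mulmx1.
have [g gE] := bm_poly q (fun h => (f h)^*); exists g.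
rewrite -gE -adj_bm -QE /Q spec_adj spec_mul //.
by apply: eq_spec => j; rewrite normCK.
Qed.

Lemma bm_poly_ker (q : {poly C}) n (v : 'M[C]_(_, n)) :
  spec_mx P (fun j => q.[(r j)%:C]) *m v = 0 ->
  spec_mx P (fun j => `|q.[(r j)%:C]| ^+ 2) *m v = 0.
Proof.
have [uP _] := dec => Qv.
rewrite (eq_spec P (h := fun j => q.[(r j)%:C]^* * q.[(r j)%:C])) => [|j].
  by rewrite -spec_mul // -mulmxA Qv mulmx0.
by rewrite normCK mulrC.
Qed.

End BoseMesnerPolynomials.

Section HermitianForm.
Context (R : realType) (n : nat).
Local Notation C := R[i].
Implicit Types u w : 'cV[C]_n.

Lemma hdotE u w : hdot u w = \sum_j u j 0 * (w j 0)^*.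
Proof. by rewrite /hdot mxE; apply: eq_bigr => j _; rewrite !mxE. Qed.

Lemma hdotZl a u w : hdot (a *: u) w = a * hdot u w.
Proof.
by rewrite !hdotE mulr_sumr; apply: eq_bigr => j _; rewrite mxE mulrA.
Qed.

Lemma hdotZr a u w : hdot u (a *: w) = a^* * hdot u w.
Proof.
rewrite !hdotE mulr_sumr; apply: eq_bigr => j _.
by rewrite mxE rmorphM /= mulrCA.
Qed.

Lemma hdot_sym_mx (M : 'M[C]_n) u w : M^T = M -> map_mx Num.conj M = M ->
  hdot (M *m u) w = hdot u (M *m w).
Proof.
move=> symM realM; rewrite /hdot trmx_mul symM -mulmxA; congr ((_ *m _) 0 0).
by rewrite -{1}realM -map_mxM.
Qed.

Lemma hdot_neq0 u : u != 0 -> hdot u u != 0.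
Proof.
apply: contraNneq; rewrite hdotE => /psumr_eq0P u0; apply/eqP/colP => j.
have /eqP := u0 (fun j _ => mul_conjC_ge0 (u j 0)) j isT.
by rewrite mul_conjC_eq0 mxE => /eqP.
Qed.

End HermitianForm.

(** * Action of the distance matrices between spheres around the base vertex *)

Section Spheres.
Context (R : realType) (X : finType) (e : rel X) (k : nat) (x : X).
Hypotheses (e_drg : bipartite_drg e) (e_val : forall y, #|[set z | e y z]| = k).
Local Notation C := R[i].
Local Notation d := (gdist e).
Local Notation D := (diameter e).
Local Notation b := (bnum e).
Local Notation c := (cnum e).
Local Notation A := (dist_mx C e 1).
Local Notation dA i := (dist_mx C e i).
Local Notation E i := (dual_idempotent C e x i).

Let e_sym : symmetric e. Proof. by case: e_drg. Qed.
Let e_irr : irreflexive e. Proof. by case: e_drg. Qed.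
Let e_conn y z : connect e y z. Proof. by case: e_drg. Qed.
Let e_bip : bipartite e. Proof. by case: e_drg. Qed.

Lemma idemE i n (u : 'M[C]_(_, n)) y z :
  (E i *m u) y z = (d x (enum_val y) == i)%:R * u y z.
Proof.
rewrite mxE (bigD1 y) //= big1 ?addr0 => [|t /negbTE ty]; rewrite mxE.
  by rewrite eqxx.
by rewrite eq_sym ty mul0r.
Qed.

Lemma idem_mul i j n (u : 'M[C]_(_, n)) : E i *m (E j *m u) = (i == j)%:R *: (E j *m u).
Proof.
apply/matrixP => y z; rewrite idemE [RHS]mxE !idemE !mulrA; congr (_ * _).
by case: (d _ _ =P j) => [->|]; rewrite ?mulr0 // eq_sym.
Qed.

Lemma idem_sym i : (E i)^T = E i.
Proof.
apply/matrixP => y z; rewrite !mxE.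
by rewrite eq_sym; case: eqP => [->|].
Qed.

Lemma idem_real i : map_mx Num.conj (E i) = E i.
Proof. by apply/matrixP => y z; rewrite !mxE rmorph_nat. Qed.

Lemma dist_sym i : (dA i)^T = dA i.
Proof. by apply/matrixP => y z; rewrite !mxE (gdist_sym e_sym e_conn). Qed.

Lemma dist_real i : map_mx Num.conj (dA i) = dA i.
Proof. by apply/matrixP => y z; rewrite !mxE rmorph_nat. Qed.

Lemma sphere_edge y z : e y z -> d x z = (d x y).+1 \/ (d x z).+1 = d x y.
Proof.
rewrite e_sym !(gdist_sym e_sym e_conn x).
by move=> /(gdist_neighbour e_drg x); case; [right|left].
Qed.

(** Neighbours of a vertex at distance $i+1$ from [x] lie at distance $i$ or $i+2$. *)
Lemma idem_adj i n (u : 'M[C]_(_, n)) :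
  E i.+1 *m (A *m u) = E i.+1 *m (A *m (E i *m u)) + E i.+1 *m (A *m (E i.+2 *m u)).
Proof.
rewrite -!mulmxDr; apply/matrixP => y z; rewrite !idemE.
have [dy|] := eqVneq (d x (enum_val y)) i.+1; last by rewrite !mul0r.
rewrite !mul1r [LHS]mxE [RHS]mxE; apply: eq_bigr => t _.
have -> : (E i *m u + E i.+2 *m u) t z = ((d x (enum_val t) == i)%:R
  + (d x (enum_val t) == i.+2)%:R) * u t z by rewrite mxE !idemE mulrDl.
rewrite mxE (gdist_eq1 e_conn) //.
case: (boolP (e _ _)) => [/sphere_edge|]; last by rewrite !mul0r.
rewrite dy -natrD; case => [->|[->]]; rewrite ?eqxx.
  by rewrite (_ : (i.+2 == i) = false) ?mul1r //; lia.
by rewrite (_ : (i == i.+2) = false) ?mul1r //; lia.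
Qed.

Lemma adj_idem i n (u : 'M[C]_(_, n)) : E i.+1 *m u = u ->
  A *m u = E i *m (A *m u) + E i.+2 *m (A *m u).
Proof.
move=> uE; apply/matrixP => y z; rewrite [RHS]mxE !idemE -mulrDl ![(A *m u) y z]mxE.
rewrite -{1}[\sum_t _]mul1r; apply/eqP; rewrite -subr_eq0 -mulrBl mulr_sumr.
apply/eqP/big1 => t _; rewrite -uE idemE mxE (gdist_eq1 e_conn) //.
case: (boolP (e _ _)) => [|]; last by rewrite !(mul0r, mulr0).
rewrite e_sym => /sphere_edge.
case: (d x (enum_val t) =P i.+1) => [->|]; last by rewrite !(mul0r, mulr0).
rewrite -natrD; case => [->|[->]]; rewrite eqxx.
  by rewrite (_ : (i.+2 == i) = false) ?subrr ?mul0r //; lia.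
by rewrite (_ : (i == i.+2) = false) ?subrr ?mul0r //; lia.
Qed.

(* Entries outside the rows at distance i and the columns at distance 2 from x
   do not matter. *)
Lemma sphere_ext i (M N : 'M[C]_#|X|) n (v : 'M[C]_(_, n)) : E 2 *m v = v ->
  (forall y z, d x (enum_val y) = i -> d x (enum_val z) = 2%N -> M y z = N y z) ->
  E i *m (M *m v) = E i *m (N *m v).
Proof.
move=> vE MN; apply/matrixP => y z; rewrite !idemE.
case: eqP => [dy|]; last by rewrite !mul0r.
congr (_ * _); rewrite !mxE; apply: eq_bigr => t _; rewrite -vE idemE.
by case: eqP => [/(MN _ _ dy) ->|] //; rewrite !(mul0r, mulr0).
Qed.

Lemma sphere_dist i y z : d x y = i -> d x z = 2%N ->
  [/\ (i <= d y z + 2)%N, (d y z <= i + 2)%N & odd (d y z) = odd i].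
Proof.
move=> <- dz; have := gdist_triangle e_conn x z y.
have := gdist_triangle e_conn y x z; have := gdist_parity e_conn e_bip x y z.
by rewrite dz (gdist_sym e_sym e_conn y x) (gdist_sym e_sym e_conn z y) /=;
  move=> /esym /addbP par le1 le2; split; [lia|lia|]; move: par; case: odd; case: odd.
Qed.

Lemma sphere_dist0 i j n (v : 'M[C]_(_, n)) : E 2 *m v = v ->
  [|| (i + 2 < j)%N, (j + 2 < i)%N | odd i != odd j] -> E i *m (dA j *m v) = 0.
Proof.
move=> vE ij; rewrite (sphere_ext (N := 0) vE) ?mul0mx ?mulmx0 // => y z dy dz.
rewrite !mxE; case: eqP => // dyz; have [] := sphere_dist dy dz; rewrite dyz.
by case/or3P: ij; [lia|lia|case: odd; case: odd].
Qed.

(** Between the spheres of radii $i+2$ and 2 only the distances $i$, $i+2$, $i+4$ occur, so there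
    the three matrices add up to the all-ones matrix. *)
Lemma sphere_dist_sum i n (v : 'M[C]_(_, n)) : E 2 *m v = v ->
  const_mx 1 *m v = 0 :> 'M[C]_(#|X|, n) ->
  E i.+2 *m (dA i *m v) + E i.+2 *m (dA i.+2 *m v) + E i.+2 *m (dA i.+4 *m v) = 0.
Proof.
move=> vE Jv; rewrite -!mulmxDr -!mulmxDl.
rewrite (sphere_ext (N := const_mx 1) vE) ?Jv ?mulmx0 // => y z dy dz.
rewrite !mxE; have [h1 h2 h3] := sphere_dist dy dz.
have : d (enum_val y) (enum_val z) \in [:: i; i.+2; i.+4].
  by rewrite !inE; lia.
rewrite !inE => /or3P[] /eqP ->; rewrite eqxx;
 do ?[rewrite (_ : (_ == _) = false); last by lia]; by rewrite ?addr0 ?add0r.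
Qed.

(** As [v] lives at distance 2 from [x], the entry of $A_2v$ at [x] is the sum of all entries of
    [v]. *)
Lemma sphere_sum0 n (v : 'M[C]_(_, n)) : E 2 *m v = v ->
  E 0 *m (dA 2 *m v) = 0 -> const_mx 1 *m v = 0 :> 'M[C]_(#|X|, n).
Proof.
move=> vE; rewrite (sphere_ext (N := const_mx 1) vE) => [sum0|y z /eqP].
  apply/matrixP => y z; move/matrixP/(_ (enum_rank x) z): sum0.
  rewrite idemE enum_rankK gdistxx mul1r [RHS]mxE => sum0.
  by rewrite [RHS]mxE -sum0 !mxE; apply: eq_bigr => t _; rewrite !mxE.
by rewrite (gdist_eq0 e_conn) => /eqP xy dz; rewrite !mxE -xy dz.
Qed.

Lemma idem_big i n (u : 'M[C]_(_, n)) : (D < i)%N -> E i *m u = 0.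
Proof.
move=> iD; apply/matrixP => y z; rewrite idemE [RHS]mxE.
case: eqP => [dy|_]; last by rewrite mul0r.
by have := gdist_diameter e x (enum_val y); rewrite dy; lia.
Qed.

Lemma sphere_bm (f : nat -> C) n (v : 'M[C]_(_, n)) : E 2 *m v = v ->
  E 2 *m (bm_mx e f *m v) = f 0%N *: (E 2 *m (dA 0 *m v))
    + f 2%N *: (E 2 *m (dA 2 *m v)) + f 4%N *: (E 2 *m (dA 4 *m v)).
Proof.
move=> vE; transitivity
  (E 2 *m ((f 0%N *: dA 0 + f 2%N *: dA 2 + f 4%N *: dA 4) *m v)); last first.
  by rewrite !mulmxDl !mulmxDr -!scalemxAl -!scalemxAr.
apply: (sphere_ext vE) => y z dy dz; rewrite !mxE.
have [h1 h2 h3] := sphere_dist dy dz.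
have : d (enum_val y) (enum_val z) \in [:: 0; 2; 4]%N by rewrite !inE; lia.
by rewrite !inE => /or3P[] /eqP -> /=; rewrite ?(mulr0, mulr1, addr0, add0r).
Qed.

Lemma orthogonal_spheres i j (u t : 'cV[C]_#|X|) : i != j ->
  hdot (E i *m u) (E j *m t) = 0.
Proof.
move=> ij; rewrite hdotE big1 // => y _; rewrite !idemE.
case: eqP => [->|]; last by rewrite !mul0r.
by rewrite (negbTE ij) mul0r rmorph0 mulr0.
Qed.

End Spheres.

(* [A] stands for the adjacency matrix, [E i] for the dual idempotents, [y j]
   for [A_j v] and [Q q] for the polynomial [q] in [A]. *)
Section ThinRecurrence.
Context (F : numFieldType) (V : lmodType F) (D : nat) (b c : nat -> nat).
Context (A : {linear V -> V}) (E : nat -> {linear V -> V}) (y : nat -> V).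
Context (form : V -> V -> F) (Q : {poly F} -> V) (eta : F).
Local Notation w i := (E i.+2 (y i)).

Hypotheses (D_ge4 : (4 <= D)%N) (c1 : c 1 = 1%N)
  (c_gt0 : forall i, (0 < i <= D)%N -> (0 < c i)%N).
Hypothesis y0A : A (y 0) = y 1.
Hypothesis yA : forall j, A (y j.+1) = (b j)%:R *: y j + (c j.+2)%:R *: y j.+2.
Hypothesis EE : forall i j u, E i (E j u) = (i == j)%:R *: E j u.
Hypothesis EA : forall i u,
  E i.+1 (A u) = E i.+1 (A (E i u)) + E i.+1 (A (E i.+2 u)).
Hypothesis AE : forall i u, E i.+1 u = u -> A u = E i (A u) + E i.+2 (A u).
Hypothesis y_far : forall i j, (i + 2 < j)%N || (j + 2 < i)%N -> E i (y j) = 0.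
Hypothesis y_sum : forall i, w i + E i.+2 (y i.+2) + E i.+2 (y i.+4) = 0.
Hypotheses (E1y1 : E 1 (y 1) = 0) (E2y0 : E 2 (y 0) = y 0)
  (E2y2 : E 2 (y 2) = eta *: y 0) (y0 : y 0 != 0).
Hypothesis lower_line : forall i, (i.+2 <= D)%N -> w i != 0 ->
  exists n, E i.+2 (A (w i.+1)) = n *: w i.
Hypothesis coef_line : forall i, (i.+2 <= D)%N -> w i != 0 ->
  exists a, E i.+2 (y i.+4) = a *: w i.
Hypotheses (Q1 : Q 1 = y 0) (QX : forall q, Q (q * 'X) = A (Q q))
  (QB : forall a p q, Q (p - a *: q) = Q p - a *: Q q)
  (QZ : forall a p, Q (a *: p) = a *: Q p).
Hypothesis Q_neq0 : forall q : {poly F}, q != 0 -> (size q < D)%N -> Q q != 0.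
Hypotheses (formZl : forall a u t, form (a *: u) t = a * form u t)
  (formZr : forall n u t, form u (n%:R *: t) = n%:R * form u t)
  (formA : forall u t, form (A u) t = form u (A t))
  (formE : forall i u t, form (E i u) t = form u (E i t))
  (form_neq0 : forall u, u != 0 -> form u u != 0).

Lemma w_fix i : E i.+2 (w i) = w i.
Proof. by rewrite EE eqxx scale1r. Qed.

(** Since $A_iv$ does not reach radius $i+4$, [w i] may be replaced by [y i]; in the recurrence for
    $A A_iv$ only $A_{i+1}v$ reaches radius $i+3$. *)
Lemma w_raise i : E i.+3 (A (w i)) = (c i.+1)%:R *: w i.+1.
Proof.
have -> : E i.+3 (A (w i)) = E i.+3 (A (y i)).
  by rewrite [RHS]EA (@y_far i.+4) ?linear0 ?addr0 //; lia.
case: i => [|i]; first by rewrite y0A c1 scale1r.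
by rewrite yA linearD !linearZ /= (@y_far i.+4) ?scaler0 ?add0r //; lia.
Qed.

Lemma y0_raise : A (y 0) = w 1.
Proof. by rewrite (AE E2y0) y0A E1y1 add0r. Qed.

Lemma w_adj i : A (w i.+1) = E i.+2 (A (w i.+1)) + (c i.+2)%:R *: w i.+2.
Proof. by rewrite -w_raise -AE // w_fix. Qed.

(** Both claims need a joint induction: [w j] being nonzero makes the lower part of [A (w j.+1)] a
    multiple of it, which presents [w j.+2] as a polynomial in [A] applied to $v$; the degree bound
    then gives that it is nonzero. *)
Lemma w_poly i : (i.+2 <= D)%N ->
  w i != 0 /\ exists2 q : {poly F}, size q = i.+1 & w i = Q q.
Proof.
have neq0 j (q : {poly F}) : (j.+2 <= D)%N -> size q = j.+1 -> w j = Q q -> w j != 0.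
  move=> jD sq ->; apply: Q_neq0; last by rewrite sq.
  by rewrite -size_poly_eq0 sq.
have one : exists2 q : {poly F}, size q = 1%N & w 0 = Q q.
  by exists 1; rewrite ?size_poly1 // Q1.
(* The recurrence has three terms, so two consecutive polynomials are carried along. *)
suff H j : (j.+3 <= D)%N ->
    (exists2 q : {poly F}, size q = j.+1 & w j = Q q) /\
    (exists2 q : {poly F}, size q = j.+2 & w j.+1 = Q q).
  case: i => [|i] iD.
    by split=> //; have [q sq wq] := one; apply: neq0 sq wq; lia.
  by have [_ [q sq wq]] := H i iD; split; [apply: neq0 sq wq|exists q].
elim: j => [|j IH] jD.
  split=> //; have [q sq wq] := one; exists (q * 'X).
    by rewrite size_mulX ?sq // -size_poly_eq0 sq.
  by rewrite QX -wq E2y0 y0_raise.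
have [[q sq wq] [q' sq' wq']] := IH (ltnW jD); split; first by exists q'.
have wj0 : w j != 0 by apply: neq0 sq wq; lia.
have [n nE] := lower_line (ltnW (ltnW jD)) wj0.
have cj0 : (c j.+2)%:R != 0 :> F by rewrite pnatr_eq0 -lt0n c_gt0 //; lia.
exists ((c j.+2)%:R^-1 *: (q' * 'X - n *: q)).
  rewrite size_scale ?invr_eq0 // size_polyDl ?size_mulX -?size_poly_eq0 ?sq' //.
  by rewrite size_polyN (leq_ltn_trans (size_scale_leq _ _)) // sq.
rewrite QZ QB QX -wq -wq' w_adj nE [_ + _ - _]addrC addKr.
by rewrite scalerA mulVf // scale1r.
Qed.

Lemma w_neq0 i : (i.+2 <= D)%N -> w i != 0.
Proof. by case/w_poly. Qed.

(** The coefficient of [t] when [t] is a multiple of [u]. The explicit quotient turns the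
    existential statements on lines into functions of the index. *)
Let coef u t := form t u / form u u.

Let coefE u t : u != 0 -> (exists a, t = a *: u) -> t = coef u t *: u.
Proof. by move=> u0 [a ->]; rewrite /coef formZl mulfK ?form_neq0. Qed.

(** These two are $n_i$ and $a_i$; the sign in the second makes $a_0 = 1+\eta$. *)
Definition lower_coef i := coef (w i) (E i.+2 (A (w i.+1))).
Definition diag_coef i := - coef (w i) (E i.+2 (y i.+4)).

Lemma lower_coefE i : (i.+2 <= D)%N -> E i.+2 (A (w i.+1)) = lower_coef i *: w i.
Proof. by move=> iD; apply: coefE; [exact: w_neq0|apply/lower_line/w_neq0]. Qed.

(* Thinness makes [E_(i+2) A_(i+2) v] and [E_(i+2) A_(i+4) v] multiples of
   [w i]; as [A_i + A_(i+2) + A_(i+4)] kills [v] on the sphere of radius [i+2],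
   their coefficients are [a - 1] and [- a]. *)
Lemma diag_coefE i : (i.+2 <= D)%N ->
  E i.+2 (y i.+4) = - diag_coef i *: w i /\
  E i.+2 (y i.+2) = (diag_coef i - 1) *: w i.
Proof.
move=> iD; have wi0 := w_neq0 iD.
have dE : E i.+2 (y i.+4) = - diag_coef i *: w i.
  by rewrite /diag_coef opprK; apply: coefE => //; apply: coef_line.
split=> //; have := y_sum i; rewrite dE => /eqP; rewrite addrC addr_eq0 scaleNr.
move/eqP/oppr_inj; rewrite scalerBl scale1r => ->.
by rewrite addrC addKr.
Qed.

Let scale_inj i a a' : (i.+2 <= D)%N -> a *: w i = a' *: w i -> a = a'.
Proof.
move=> /w_neq0 wi0 /eqP; rewrite -subr_eq0 -scalerBl scaler_eq0 (negbTE wi0) orbF.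
by rewrite subr_eq0 => /eqP.
Qed.

Lemma diag_coef0 : diag_coef 0 = 1 + eta.
Proof.
have D2 : (2 <= D)%N by lia.
have [_ dE] := diag_coefE D2.
have etaE : eta *: w 0 = (diag_coef 0 - 1) *: w 0 by rewrite -dE E2y2 E2y0.
by rewrite (scale_inj D2 etaE) addrC subrK.
Qed.

(** The component of $A A_{i+1}v$ at radius $i+2$ is computed twice: through the spheres of radii
    $i+1$ (which contributes [p]) and $i+3$, and by the three-term recurrence. *)
Lemma w_rec i p : (i.+2 <= D)%N -> E i.+2 (A (E i.+1 (y i.+1))) = p *: w i ->
  p + lower_coef i = (b i)%:R + (c i.+2)%:R * (diag_coef i - 1).
Proof.
move=> iD pE; apply: (scale_inj iD); rewrite !scalerDl -pE -lower_coefE // -EA yA.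
by have [_ dE] := diag_coefE iD; rewrite linearD !linearZ /= dE scalerA.
Qed.

Lemma lower_coef0 : lower_coef 0 = (b 0)%:R + (c 2)%:R * (diag_coef 0 - 1).
Proof. by rewrite -(@w_rec 0 0) ?add0r ?E1y1 ?linear0 ?scale0r //; lia. Qed.

Lemma lower_coefS i : (i.+3 <= D)%N ->
  (c i.+1)%:R * (diag_coef i - 1) + lower_coef i.+1
  = (b i.+1)%:R + (c i.+3)%:R * (diag_coef i.+1 - 1).
Proof.
move=> iD; apply: w_rec => //; have [_ ->] := diag_coefE (ltnW iD).
by rewrite !linearZ /= w_raise scalerA mulrC.
Qed.

(** Compare components of $A A_{i+5}v$ at radius $i+2$. Only radius $i+3$ contributes on one side
    and only $A_{i+4}v$ on the other, the remaining terms being out of reach. *)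
Lemma diag_coefS i : (i.+3 <= D)%N ->
  diag_coef i.+1 * lower_coef i = (b i.+4)%:R * diag_coef i.
Proof.
move=> iD; apply/oppr_inj/(scale_inj (ltnW iD)).
have [dE _] := diag_coefE (ltnW iD); have [dE' _] := diag_coefE iD.
rewrite -mulNr -scalerA -lower_coefE ?(ltnW iD) // -linearZ -linearZ /= -dE'.
have := EA i.+1 (y i.+1.+4); rewrite (@y_far i.+1 i.+1.+4) ?linear0 ?add0r; last lia.
move=> <-; rewrite yA linearD !linearZ /= dE (@y_far i.+2 i.+2.+4) ?scaler0; last lia.
by rewrite addr0 scalerA mulrN.
Qed.

Lemma lower_coef_form i : (i.+2 <= D)%N ->
  lower_coef i * form (w i) (w i) = (c i.+1)%:R * form (w i.+1) (w i.+1).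
Proof.
move=> iD; rewrite -formZl -lower_coefE // formE w_fix formA.
by rewrite -{1}(w_fix i.+1) formE w_raise formZr.
Qed.

Lemma thin_recurrence : exists a n : nat -> F,
  (forall i, (i.+2 <= D)%N -> w i != 0) /\
  [/\ a 0%N = 1 + eta,
      n 0%N = (b 0)%:R + (c 2)%:R * (a 0%N - 1),
      forall i, (i.+4 <= D)%N -> (c i.+1)%:R * (a i - 1) + n i.+1
        = (b i.+1)%:R + (c i.+3)%:R * (a i.+1 - 1),
      forall i, (i.+3 <= D)%N -> a i.+1 * n i = (b i.+4)%:R * a i &
      forall i, (i.+3 <= D)%N ->
        n i * form (w i) (w i) = (c i.+1)%:R * form (w i.+1) (w i.+1)].
Proof.
exists diag_coef, lower_coef; split; first exact: w_neq0.
split=> [|| i iD | i iD | i iD].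
- exact: diag_coef0.
- exact: lower_coef0.
- by apply: lower_coefS; lia.
- exact: diag_coefS.
- by apply: lower_coef_form; lia.
Qed.

End ThinRecurrence.

Local Opaque dist_mx dual_idempotent bm_mx spec_mx mulmx.

(** * The recurrence for a thin module with endpoint two *)

Section ThinModule.
Context (R : realType) (X : finType) (e : rel X) (k : nat) (theta : seq R) (x : X).
Local Notation C := R[i].
Context (W : {vspace 'cV[C]_#|X|}) (eta : R) (v : 'cV[C]_#|X|).
Hypotheses (e_drg : bipartite_drg e) (e_val : forall y, #|[set z | e y z]| = k).
Local Notation d := (gdist e).
Local Notation D := (diameter e).
Hypothesis D_ge4 : (4 <= D)%N.
Hypotheses (size_theta : size theta = D.+1) (e_theta : graph_eigenvalues e theta).
Hypotheses (W_mod : T_module e x W) (W_thin : thin e x W)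
  (W_end : has_endpoint e x W 2) (W_loc : local_eigenvalue e x W eta%:C).
Hypotheses (eta1 : theta_tilde e theta`_1 < eta)
  (etad : eta < theta_tilde e theta`_(D./2)).
Hypotheses (vW : v \in layer e x 2 W) (v0 : v != 0).
Local Notation b := (bnum e).
Local Notation c := (cnum e).
Local Notation A := (dist_mx C e 1).
Local Notation dA i := (dist_mx C e i).
Local Notation E i := (dual_idempotent C e x i).
Local Notation w i := (E i.+2 *m (dA i *m v)).

Let e_sym : symmetric e. Proof. by case: e_drg. Qed.
Let e_irr : irreflexive e. Proof. by case: e_drg. Qed.
Let e_conn y z : connect e y z. Proof. by case: e_drg. Qed.
Let e_bip : bipartite e. Proof. by case: e_drg. Qed.

Lemma mem_layer i u : u \in W -> E i *m u \in layer e x i W.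
Proof. by move=> uW; apply/memv_imgP; exists u; rewrite ?lfunE. Qed.

Lemma layer_sub i u : (i <= D)%N -> u \in layer e x i W -> u \in W.
Proof.
move=> iD /memv_imgP[t tW ->]; rewrite lfunE /=.
by apply: W_mod tW; apply: Terwilliger_idem.
Qed.

Lemma layer_line i u t : (i <= D)%N -> u \in layer e x i W -> u != 0 ->
  t \in layer e x i W -> exists a, t = a *: u.
Proof.
move=> iD uL u0 tL; apply/vlineP.
suff -> : (<[u]> = layer e x i W)%VS by [].
apply/eqP; rewrite eqEdim -memvE uL dim_vline u0; exact: W_thin.
Qed.

Lemma below_endpoint i u : (i < 2)%N -> u \in W -> E i *m u = 0.
Proof.
move=> i2 uW; have [_ /(_ i i2) L0] := W_end.
by apply/eqP; rewrite -memv0 -L0 mem_layer.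
Qed.

Lemma vE : E 2 *m v = v.
Proof.
case/memv_imgP: vW => t _ ->; rewrite lfunE /=.
by rewrite idem_mul eqxx scale1r.
Qed.

Lemma adj_dist_v j :
  A *m (dA j.+1 *m v) = (b j)%:R *: (dA j *m v) + (c j.+2)%:R *: (dA j.+2 *m v).
Proof. by rewrite mulmxA (adj_mul_dist C e_drg) mulmxDl -!scalemxAl. Qed.

(** The recurrence yields $A_{i+2}v$ after division by $c_{i+2}$, which is nonzero up to the
    diameter; beyond it the matrix is zero. *)
Lemma dist_v_mem j : dA j *m v \in W.
Proof.
have vW' : v \in W by apply: layer_sub vW; lia.
have AW u : u \in W -> A *m u \in W by apply/W_mod/Terwilliger_adj.
suff H i : (dA i *m v \in W) && (dA i.+1 *m v \in W) by have [Hj _] := andP (H j).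
elim: i => [|i /andP[IH1 IH2]]; first by rewrite (dist_mx0 C e_drg) mul1mx vW' AW.
rewrite IH2 /=; have [iD|iD] := leqP i.+2 D; last by rewrite dist_mx_big ?mul0mx ?mem0v.
have ci0 : (c i.+2)%:R != 0 :> C.
  by rewrite pnatr_eq0 -lt0n (cnum_gt0 e_drg x).
have dE : (c i.+2)%:R *: (dA i.+2 *m v) = A *m (dA i.+1 *m v) - (b i)%:R *: (dA i *m v).
  by rewrite adj_dist_v addrC addKr.
rewrite -[dA _ *m v]scale1r -(mulVf ci0) -scalerA dE memvZ //.
by apply: memvB; [exact: AW|apply: memvZ].
Qed.

Lemma w_mem i : w i \in layer e x i.+2 W.
Proof. exact/mem_layer/dist_v_mem. Qed.

Lemma ones_v : const_mx 1 *m v = 0 :> 'cV[C]_#|X|.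
Proof.
apply: (sphere_sum0 e_drg vE).
by rewrite (below_endpoint _ (dist_v_mem 2)).
Qed.

(** The eigenvector supplied by [local_eigenvalue] spans the line $E^*_2W$, so [v] is a multiple of
    it. *)
Lemma local_action : E 2 *m (dA 2 *m v) = eta%:C *: v.
Proof.
case: W_loc => u [uL u0 uE].
have D2 : (2 <= D)%N by lia.
have [a va] := layer_line D2 uL u0 vW.
have Ev : E 2 *m dA 2 *m E 2 *m v = eta%:C *: v.
  by rewrite va -scalemxAr uE !scalerA mulrC.
by rewrite -[RHS]Ev -!mulmxA vE.
Qed.

Lemma w_sum i : w i + E i.+2 *m (dA i.+2 *m v) + E i.+2 *m (dA i.+4 *m v) = 0.
Proof. by apply: (sphere_dist_sum e_drg); [exact: vE|exact: ones_v]. Qed.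

Lemma w_lower i : (i.+2 <= D)%N -> w i != 0 ->
  exists n : C, E i.+2 *m (A *m w i.+1) = n *: w i.
Proof.
move=> iD wi0; suff H : A *m w i.+1 \in W.
  exact: (layer_line iD (w_mem i) wi0 (mem_layer i.+2 H)).
apply: W_mod; first exact: Terwilliger_adj.
(* For $i = D-2$ the vector [w i.+1] lives on the empty sphere of radius $D+1$. *)
have [i3|i3] := leqP i.+3 D; first exact: layer_sub i3 (w_mem i.+1).
by rewrite idem_big // mem0v.
Qed.

Lemma w_upper i : (i.+2 <= D)%N -> w i != 0 ->
  exists a : C, E i.+2 *m (dA i.+4 *m v) = a *: w i.
Proof.
move=> iD wi0.
exact: (layer_line iD (w_mem i) wi0 (mem_layer i.+2 (dist_v_mem i.+4))).
Qed.

Section Nonvanishing.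
Context (P : 'M[C]_#|X|) (r : 'I_#|X| -> R).
Hypothesis dec : spectral_decomposition (dist_mx R e 1) P r.
Local Notation poly_mx q := (spec_mx P (fun j => q.[(r j)%:C])).

(** On the sphere of radius 2 the matrices $A_0$, $A_2$, $A_4$ act on [v] by 1, $\eta$ and
    $-(1+\eta)$; the scalar is the one in [local_nonvanishing]. *)
Lemma idem_bm (f : nat -> C) : E 2 *m (bm_mx e f *m v)
  = (f 0%N + eta%:C * f 2%N - (1 + eta)%:C * f 4%N) *: v.
Proof.
have Edist0 : E 2 *m (dA 0 *m v) = v by rewrite (dist_mx0 C e_drg) mul1mx vE.
have Edist4 : E 2 *m (dA 4 *m v) = - (1 + eta)%:C *: v.
  have := w_sum 0; rewrite Edist0 local_action => /eqP.
  rewrite addrC addr_eq0 => /eqP ->.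
  by rewrite rmorphD /= rmorph1 scaleNr scalerDl scale1r.
rewrite (sphere_bm e_drg f vE) Edist4 local_action Edist0 !scalerA -!scalerDl.
by congr (_ *: _); ring.
Qed.

Lemma poly_v_neq0 (q : {poly C}) : q != 0 -> (size q < D)%N -> poly_mx q *m v != 0.
Proof.
move=> q0 sq; apply/negP => /eqP /bm_poly_ker => /(_ _ dec) qv.
have [f fE] := bm_poly_norm e_drg dec q.
have := local_nonvanishing x e_drg e_val D_ge4 dec size_theta e_theta eta1 etad q0 sq fE.
have := idem_bm f; rewrite fE qv mulmx0 => /esym /eqP.
by rewrite scaler_eq0 (negbTE v0) orbF => ->.
Qed.

Lemma thin_relations : exists a n : nat -> C,
  (forall i, (i.+2 <= D)%N -> w i != 0) /\
  [/\ a 0%N = 1 + eta%:C,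
      n 0%N = (b 0)%:R + (c 2)%:R * (a 0%N - 1),
      forall i, (i.+4 <= D)%N -> (c i.+1)%:R * (a i - 1) + n i.+1
        = (b i.+1)%:R + (c i.+3)%:R * (a i.+1 - 1),
      forall i, (i.+3 <= D)%N -> a i.+1 * n i = (b i.+4)%:R * a i &
      forall i, (i.+3 <= D)%N ->
        n i * hdot (w i) (w i) = (c i.+1)%:R * hdot (w i.+1) (w i.+1)].
Proof.
have [uP _] := dec.
have c1 : c 1 = 1%N by rewrite (cnum1 e_drg x) //; lia.
have dA0 : dA 0 *m v = v by rewrite (dist_mx0 C e_drg) mul1mx.
have QX (q : {poly C}) : poly_mx (q * 'X) *m v = A *m (poly_mx q *m v).
  rewrite mulmxA (adj_spec dec); congr (_ *m v).
  by apply: eq_spec => j; rewrite hornerMX mulrC.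
have QB a (p q : {poly C}) :
    poly_mx (p - a *: q) *m v = poly_mx p *m v - a *: (poly_mx q *m v).
  rewrite scalemxAl -mulmxBl; congr (_ *m v).
  rewrite spec_scale spec_sub; apply: eq_spec => j.
  by rewrite hornerD hornerN hornerZ.
have QZ a (p : {poly C}) : poly_mx (a *: p) *m v = a *: (poly_mx p *m v).
  rewrite scalemxAl; congr (_ *m v).
  by rewrite spec_scale; apply: eq_spec => j; rewrite hornerZ.
apply: (@thin_recurrence C 'cV[C]_#|X| D b c (mulmx A) (fun i => mulmx (E i))
  (fun j => dA j *m v) (@hdot R _) (fun q => poly_mx q *m v) eta%:C).
- exact: D_ge4.
- exact: c1.
- exact: (cnum_gt0 e_drg x).
- by rewrite dA0.
- exact: adj_dist_v.
- by move=> i j u; apply: idem_mul.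
- by move=> i u; apply: idem_adj.
- by move=> i u; apply: adj_idem.
- move=> i j far; apply: (sphere_dist0 e_drg vE).
  by apply/or3P; case/orP: far => ?; [apply: Or31|apply: Or32].
- exact: w_sum.
- exact: (below_endpoint (isT : (1 < 2)%N) (dist_v_mem 1)).
- by rewrite dA0; apply: vE.
- by rewrite dA0; apply: local_action.
- by rewrite dA0.
- exact: w_lower.
- exact: w_upper.
- rewrite dA0 (eq_spec P (h := fun=> 1)) => [|j]; last by rewrite hornerC.
  by rewrite spec_const // mul1mx.
- exact: QX.
- exact: QB.
- exact: QZ.
- exact: poly_v_neq0.
- exact: hdotZl.
- by move=> n u t; rewrite hdotZr rmorph_nat.
- move=> u t; apply: hdot_sym_mx; [exact: dist_sym|exact: dist_real].
- move=> i u t; apply: hdot_sym_mx; [exact: idem_sym|exact: idem_real].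
- exact: hdot_neq0.
Qed.

End Nonvanishing.

End ThinModule.

(** * The norm formula *)

Section NormFormula.
Context (F : fieldType) (D : nat) (b c K N a n P : nat -> F) (k eta psi : F).
Hypotheses (D_ge4 : (4 <= D)%N) (c1 : c 1 = 1) (b0 : b 0 = k)
  (bDc : forall i, (i <= D)%N -> b i + c i = k)
  (c_neq0 : forall i, (0 < i <= D)%N -> c i != 0)
  (b_neq0 : forall i, (i < D)%N -> b i != 0).
Hypotheses (K0 : K 0 = 1) (KS : forall i, (i < D)%N -> K i.+1 * c i.+1 = K i * b i).
Hypotheses (a0 : a 0 = 1 + eta) (n0 : n 0 = b 0 + c 2 * (a 0 - 1))
  (nS : forall i, (i.+4 <= D)%N ->
     c i.+1 * (a i - 1) + n i.+1 = b i.+1 + c i.+3 * (a i.+1 - 1))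
  (aS : forall i, (i.+3 <= D)%N -> a i.+1 * n i = b i.+4 * a i)
  (nN : forall i, (i.+3 <= D)%N -> n i * N i = c i.+1 * N i.+1)
  (N_neq0 : forall i, (i.+2 <= D)%N -> N i != 0).

(** Up to the factor $c_{i+1}$, this is a ratio of two nonzero norms. *)
Let n_neq0 i : (i.+3 <= D)%N -> n i != 0.
Proof.
move=> iD; have : n i * N i != 0 by rewrite nN // mulf_neq0 ?N_neq0 ?c_neq0 //; lia.
by rewrite mulf_eq0 negb_or => /andP[].
Qed.

Let n0E : n 0 = b 2 + c 2 * a 0.
Proof. by rewrite n0 b0 -(@bDc 2) //; [ring|lia]. Qed.

Let nSE i : (i.+4 <= D)%N -> n i.+1 = b i.+3 + c i.+3 * a i.+1 - c i.+1 * a i.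
Proof.
move=> iD; have := nS iD; move/(canRL (addKr _)) => ->.
have h1 : b i.+1 = k - c i.+1 by rewrite -(@bDc i.+1) ?addrK //; lia.
have h3 : b i.+3 = k - c i.+3 by rewrite -(@bDc i.+3) ?addrK //; lia.
by rewrite h1 h3; ring.
Qed.

(** From $a_0=0$ all $a_j$ vanish because $n_j\ne 0$. Then $n_j=b_{j+2}$, and the ratios
    $N_{j+1}/N_j=b_{j+2}/c_{j+1}$ telescope. *)
Lemma norm_formula_degenerate i : eta = -1 -> (i.+2 <= D)%N ->
  N i = K i * b i * b i.+1 / (k * b 1) * N 0.
Proof.
move=> eta1; have az j : (j.+2 <= D)%N -> a j = 0.
  elim: j => [|j IH] jD; first by rewrite a0 eta1 subrr.
  have /eqP := aS jD; rewrite IH ?mulr0; last by lia.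
  by rewrite mulf_eq0 (negbTE (n_neq0 jD)) orbF => /eqP.
have nE j : (j.+3 <= D)%N -> n j = b j.+2.
  case: j => [|j] jD; first by rewrite n0E az ?mulr0 ?addr0 //; lia.
  by rewrite nSE // !az ?mulr0 ?addr0 ?subr0 //; lia.
have b1 : b 1 != 0 by apply: b_neq0; lia.
have kn0 : k != 0 by rewrite -b0; apply: b_neq0; lia.
elim: i => [|i IH] iD; first by rewrite K0 b0 mul1r divff ?mul1r // mulf_neq0.
have ci : c i.+1 != 0 by apply: c_neq0; lia.
apply: (mulfI ci); rewrite -nN // nE // IH; last by lia.
have <- : K i.+1 * c i.+1 = K i * b i by apply: KS; lia.
by field; rewrite b1.
Qed.

Hypotheses (P0 : P 0 = 1) (P1 : P 1 = 1)
  (PS : forall i, (i.+2 <= D)%N ->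
     c i.+2 * P i.+2 + b i.+2 * P i = (if odd i then 1 else psi) * P i.+1).
Hypotheses (eta_neq : eta != -1) (psiE : psi = b 2 * (1 - b 3 / (1 + eta))).

Let eta0 : 1 + eta != 0.
Proof. by rewrite addrC; apply: contra eta_neq; rewrite addr_eq0. Qed.

Let c2P2 : c 2 * P 2 = psi - b 2.
Proof.
have := PS (i := 0); rewrite P0 P1 !mulr1 /= => <-; last by lia.
by rewrite addrK.
Qed.

Let psiB : psi - b 2 = - (b 2 * b 3 / (1 + eta)).
Proof. by rewrite psiE; ring. Qed.

Let psiB_neq0 : psi - b 2 != 0.
Proof.
by rewrite psiB oppr_eq0 !mulf_neq0 ?invr_eq0 ?eta0 ?b_neq0 //; lia.
Qed.

(* With [p_i] the values of the polynomials [P_i] at [psi]: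
   [a_i = - b_(i+2) b_(i+3) p_i / (c_(i+1) c_(i+2) p_(i+2))] and
   [n_i = b_(i+2) c_(i+3) p_i p_(i+3) / (c_(i+1) p_(i+1) p_(i+2))]. *)
Lemma coef_formulas i : (i.+3 <= D)%N ->
  [/\ P i != 0, P i.+1 != 0, P i.+2 != 0,
      a i * (c i.+1 * c i.+2 * P i.+2) = - (b i.+2 * b i.+3 * P i) &
      n i * (c i.+1 * P i.+1 * P i.+2) = b i.+2 * c i.+3 * P i.+3 * P i].
Proof.
elim: i => [|i IH] iD.
  have P2 : P 2 != 0.
    by apply: contraNneq psiB_neq0 => P20; rewrite -c2P2 P20 mulr0.
  have aE : a 0 * (c 1 * c 2 * P 2) = - (b 2 * b 3 * P 0).
    rewrite c1 mul1r c2P2 psiB a0 P0; field; exact: eta0.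
  split=> //; rewrite ?P0 ?P1 ?oner_neq0 //.
  have p3 := PS (i := 1); rewrite /= mul1r P1 mulr1 in p3.
  rewrite n0E.
  transitivity (b 2 * P 2 * c 1 + a 0 * (c 1 * c 2 * P 2)); first by ring.
  by rewrite aE P0 c1 -p3; [ring|lia].
have [Pi Pi1 Pi2 aE nE] := IH (ltnW iD).
have ni : n i != 0 by apply: n_neq0; lia.
have ci1 : c i.+1 != 0 by apply: c_neq0; lia.
have ci2 : c i.+2 != 0 by apply: c_neq0; lia.
(* The factor $P_{i+3}$ divides the formula for $n_i$, which is nonzero. *)
have Pi3 : P i.+3 != 0.
  have : n i * (c i.+1 * P i.+1 * P i.+2) != 0 by rewrite !mulf_neq0.
  by apply: contraNneq => P3; rewrite nE P3 !(mul0r, mulr0).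
(* Multiplying by $n_i$ lets $a_{i+1}n_i = b_{i+4}a_i$ bring the claim back to index $i$. *)
have aE' : a i.+1 * (c i.+2 * c i.+3 * P i.+3) = - (b i.+3 * b i.+4 * P i.+1).
  have nz : n i * c i.+1 * P i.+2 != 0 by rewrite !mulf_neq0.
  apply: (mulIf nz).
  transitivity ((a i.+1 * n i) * (c i.+1 * c i.+2 * P i.+2) * (c i.+3 * P i.+3)).
    by ring.
  rewrite aS ?(ltnW iD) //.
  transitivity (b i.+4 * (a i * (c i.+1 * c i.+2 * P i.+2)) * (c i.+3 * P i.+3)).
    by ring.
  rewrite aE.
  transitivity (- (b i.+4 * b i.+3 * (b i.+2 * c i.+3 * P i.+3 * P i))); first by ring.
  by rewrite -nE; ring.
split=> //; rewrite nSE //.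
(* The instances at $i$ and $i+2$ share the parity factor, which is what lets them be combined. *)
have ps1 := PS (ltnW (ltnW iD)).
have ps3 := PS iD; rewrite /= negbK in ps3.
transitivity (b i.+3 * P i.+3 * (c i.+2 * P i.+2) * 1
  + (a i.+1 * (c i.+2 * c i.+3 * P i.+3)) * P i.+2
  - (a i * (c i.+1 * c i.+2 * P i.+2)) * P i.+3); first by ring.
rewrite aE aE'.
transitivity (b i.+3 * P i.+3 * (c i.+2 * P i.+2 + b i.+2 * P i)
   - b i.+3 * b i.+4 * P i.+1 * P i.+2); first by ring.
rewrite ps1.
transitivity (b i.+3 * P i.+1 * ((if odd i then 1 else psi) * P i.+3
   - b i.+4 * P i.+2)); first by ring.
by rewrite -ps3; ring.
Qed.

Lemma P_neq0 i : (i.+2 <= D)%N -> P i != 0.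
Proof.
by case: i => [|i] iD; [rewrite P0 oner_neq0 | have [] := coef_formulas iD].
Qed.

(** By [coef_formulas] the ratio $N_{i+1}/N_i = n_i/c_{i+1}$ has a closed form, and the product
    telescopes. *)
Lemma norm_formula i : (i.+2 <= D)%N ->
  N i = K i * b i * b i.+1 * c i.+1 * c i.+2 / (k * b 1 * (psi - b 2))
    * (P i.+2 / P i) * N 0.
Proof.
have b1 : b 1 != 0 by apply: b_neq0; lia.
have kn0 : k != 0 by rewrite -b0; apply: b_neq0; lia.
elim: i => [|i IH] iD.
  rewrite K0 b0 P0 c1 divr1 -c2P2.
  have c2 : c 2 != 0 by apply: c_neq0; lia.
  have P2 : P 2 != 0 by apply: contraNneq psiB_neq0 => P20; rewrite -c2P2 P20 mulr0.
  by field; rewrite b1 kn0 c2 P2.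
have [Pi Pi1 Pi2 _ nE] := coef_formulas iD.
have ci1 : c i.+1 != 0 by apply: c_neq0; lia.
have nE' : n i = b i.+2 * c i.+3 * P i.+3 * P i / (c i.+1 * P i.+1 * P i.+2).
  by rewrite -nE mulfK // !mulf_neq0.
apply: (mulfI ci1); rewrite -nN // nE' IH; last by lia.
have <- : K i.+1 * c i.+1 = K i * b i by apply: KS; lia.
by field; rewrite ci1 Pi Pi1 Pi2 b1 kn0 psiB_neq0.
Qed.

End NormFormula.

(** * The recurrence for the polynomials $P_i$ *)

Section Polynomials.
Context (R : realType) (X : finType) (e : rel X) (k : nat) (x0 : X).
Hypotheses (e_drg : bipartite_drg e) (e_val : forall y, #|[set z | e y z]| = k).
Local Notation D := (diameter e).
Local Notation b i := ((bnum e i)%:R : R).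
Local Notation c i := ((cnum e i)%:R : R).
Local Notation f := (fpoly R e).
Local Notation p := (ppoly R e).
Local Notation P := (Ppoly R e).

Lemma ppolySS i : p i.+2 = f i.+2 + p i.
Proof.
rewrite /ppoly big_mkcond big_ord_recr /= eqxx big_ord_recr /=.
rewrite !negbK (_ : (~~ odd i == odd i) = false) ?addr0; last by case: odd.
by rewrite addrC -big_mkcond.
Qed.

Let cn0 i : (0 < i <= D)%N -> c i != 0.
Proof. by move=> iD; rewrite pnatr_eq0 -lt0n (cnum_gt0 e_drg x0). Qed.

Lemma fpoly_rec i : (i.+2 <= D)%N ->
  'X * f i.+1 = b i *: f i + c i.+2 *: f i.+2.
Proof.
move=> iD; rewrite [f i.+2]/= -/(f i.+1) scalerA divff ?scale1r ?cn0 //.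
by rewrite addrC subrK.
Qed.

Lemma ppoly0 : p 0 = 1.
Proof. by rewrite /ppoly big_mkcond big_ord1 eqxx. Qed.

Lemma ppoly1 : (0 < D)%N -> p 1 = 'X.
Proof.
move=> D0; rewrite /ppoly big_mkcond big_ord_recr big_ord1 /= add0r.
by rewrite (cnum1 e_drg x0) // invr1 scale1r.
Qed.

(** Add the recurrences for the $f_j$ of one parity: every $f_j$ below the top gets the coefficient
    $b_j+c_j=k=b_{i+2}+c_{i+2}$. *)
Lemma ppoly_rec i : (i.+2 <= D)%N ->
  'X * p i.+1 = c i.+2 *: p i.+2 + b i.+2 *: p i.
Proof.
have bDc j : (j <= D)%N -> b j + c j = k%:R.
  by move=> jD; rewrite -natrD (bnumDcnum e_drg e_val).
have f1 : (0 < D)%N -> f 1 = 'X.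
  by move=> D0; rewrite /= (cnum1 e_drg x0) // invr1 scale1r.
elim/ltn_ind: i => -[|[|i]] IH iD.
- have := fpoly_rec iD; rewrite f1; last by lia.
  rewrite ppolySS ppoly0 ppoly1 => [->|]; last by lia.
  rewrite scalerDr -addrA -scalerDl [c 2 + _]addrC bDc //.
  by rewrite addrC (bnum0 e_drg e_val x0).
- have := fpoly_rec iD; rewrite f1; last by lia.
  rewrite ppolySS [p 3]ppolySS ppoly0 mulrDr mulr1 ppoly1 => [->|]; last by lia.
  rewrite scalerDr -[in RHS]addrA -scalerDl [c 3 + _]addrC bDc //.
  rewrite -(@bDc 1); last by lia.
  rewrite (cnum1 e_drg x0); last by lia.
  by rewrite scalerDl scale1r addrAC addrC.
- rewrite ppolySS mulrDr fpoly_rec // IH //; last by lia.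
  rewrite [p i.+4]ppolySS scalerDr -[in RHS]addrA -scalerDl [c i.+4 + _]addrC.
  rewrite bDc // -(@bDc i.+2); last by lia.
  by rewrite [p i.+2]ppolySS -!mul_polyC polyCD; ring.
Qed.

(** Multiplying an odd $p_{i+1}$ by ['X] creates a factor ['X^2], which becomes ['X] in the even
    part; an even $p_{i+1}$ just becomes odd. *)
Lemma Ppoly_rec i : (i.+2 <= D)%N ->
  c i.+2 *: P i.+2 + b i.+2 *: P i = (if odd i then 1 else 'X) * P i.+1.
Proof.
move=> iD; have := ppoly_rec iD; rewrite /Ppoly /= negbK.
case: (odd i) => /= pE.
  by rewrite mul1r -!odd_polyZ -odd_polyD -pE -commr_polyX odd_polyMX.
by rewrite -!even_polyZ -even_polyD -pE -!commr_polyX even_polyMX.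
Qed.

End Polynomials.

(** * Orthogonality and norms of the vectors $E^*_{i+2}A_iv$ *)

Theorem theorem16p5 (R : realType) (X : finType) (e : rel X) (D k : nat)
    (theta : D.+1.-tuple R) (x : X)
    (W : {vspace 'cV[R[i]]_#|X|}) (eta : R) (v : 'cV[R[i]]_#|X|)
    (hG : bipartite_drg e)
    (hdiam : diameter e = D) (hD : (4 <= D)%N)
    (hval : forall y : X, #|[set z | e y z]| = k) (hk : (3 <= k)%N)
    (htheta : graph_eigenvalues e theta)
    (hirr : T_irreducible e x W) (hthin : thin e x W)
    (hend : has_endpoint e x W 2)
    (hloc : local_eigenvalue e x W eta%:C)
    (heta1 : theta_tilde e theta`_1 < eta)
    (hetad : eta < theta_tilde e theta`_(D./2))
    (hv : v \in layer e x 2 W) (hv0 : v != 0) :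
  let b i : R := (bnum e i)%:R in
  let c i : R := (cnum e i)%:R in
  let w i : 'cV[R[i]]_#|X| :=
    dual_idempotent R[i] e x (i + 2) *m dist_mx R[i] e i *m v in
  [/\ forall i j : nat, (i <= D - 2)%N -> (j <= D - 2)%N -> i != j ->
        hdot (w i) (w j) = 0,
      eta != -1 ->
        let psi : R := b 2%N * (1 - b 3%N / (1 + eta)) in
        forall i : nat, (i <= D - 2)%N ->
          (Ppoly R e i).[psi] != 0 /\
          hdot (w i) (w i) =
            (knum R e i * b i * b i.+1 * c i.+1 * c i.+2
               / (k%:R * b 1%N * (psi - b 2%N))
             * ((Ppoly R e i.+2).[psi] / (Ppoly R e i).[psi]))%:C
            * hdot v v
    & eta = -1 ->
        forall i : nat, (i <= D - 2)%N ->
          hdot (w i) (w i) =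
            (knum R e i * b i * b i.+1 / (k%:R * b 1%N))%:C * hdot v v].
Proof.
move=> b c w; subst D.
have wE i : w i = dual_idempotent R[i] e x i.+2 *m (dist_mx R[i] e i *m v).
  by rewrite /w addn2 mulmxA.
have w0E : w 0 = v by rewrite wE (dist_mx0 _ hG) mul1mx (vE hv).
have [W_mod _ _] := hirr.
have symA : (dist_mx R e 1)^T = dist_mx R e 1 by rewrite dist_mxE trmx_bm.
have [P [r dec]] := symmetric_spectral symA.
have [a [n [w_neq0 [a0 n0 nS aS nN]]]] := thin_relations hG hval hD (size_tuple theta)
  htheta W_mod hthin hend hloc heta1 hetad hv hv0 dec.
(* The real data are embedded into the complex numbers, where the norms and the coefficients $a_i$,
   $n_i$ live. *)
pose bC i : R[i] := (bnum e i)%:R; pose cC i : R[i] := (cnum e i)%:R.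
pose KC i := (knum R e i)%:C; pose NC i := hdot (w i) (w i).
have D2 i : (i <= diameter e - 2)%N -> (i.+2 <= diameter e)%N by lia.
have c1 : (cnum e 1)%:R = 1 :> R[i] by rewrite (cnum1 hG x) //; lia.
have b0 : (bnum e 0)%:R = k%:R :> R[i] by rewrite (bnum0 hG hval x).
have bDc i : (i <= diameter e)%N -> (bnum e i)%:R + (cnum e i)%:R = k%:R :> R[i].
  by move=> iD; rewrite -natrD (bnumDcnum hG hval x).
have c_neq0 i : (0 < i <= diameter e)%N -> (cnum e i)%:R != 0 :> R[i].
  by move=> iD; rewrite pnatr_eq0 -lt0n (cnum_gt0 hG x).
have b_neq0 i : (i < diameter e)%N -> (bnum e i)%:R != 0 :> R[i].
  by move=> iD; rewrite pnatr_eq0 -lt0n (bnum_gt0 hG x).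
have K0 : (knum R e 0)%:C = 1 by rewrite /knum !big_ord0 divr1.
have KS i : (i < diameter e)%N ->
    (knum R e i.+1)%:C * (cnum e i.+1)%:R = (knum R e i)%:C * (bnum e i)%:R.
  move=> iD; have ci : c i.+1 != 0 by rewrite pnatr_eq0 -lt0n (cnum_gt0 hG x).
  rewrite -!(rmorph_nat (real_complex R)) -!rmorphM; congr (_%:C).
  by rewrite /knum !big_ord_recr invfM mulrA mulfVK // mulrAC.
have N_neq0 i : (i.+2 <= diameter e)%N -> hdot (w i) (w i) != 0.
  by move=> iD; rewrite wE; apply/hdot_neq0/w_neq0.
have nN' i : (i.+3 <= diameter e)%N ->
    n i * hdot (w i) (w i) = (cnum e i.+1)%:R * hdot (w i.+1) (w i.+1).
  by move=> iD; rewrite !wE; apply: nN.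
split=> [i j iD jD ij | eta_neq psi i iD | eta1 i iD].
- by rewrite !wE orthogonal_spheres.
- have eta_neq' : eta%:C != -1 by rewrite -(rmorphN1 (real_complex R)) (inj_eq (@complexI R)).
  have psiE : psi%:C = (bnum e 2)%:R * (1 - (bnum e 3)%:R / (1 + eta%:C)).
    rewrite /psi rmorphM rmorphB rmorph1 fmorph_div rmorphD rmorph1 /=.
    by rewrite !(rmorph_nat (real_complex R)).
  clearbody psi; pose PC i := (Ppoly R e i).[psi]%:C.
  have P0 : (Ppoly R e 0).[psi]%:C = 1.
    by rewrite /Ppoly /= ppoly0 even_polyC hornerC.
  have P1 : (Ppoly R e 1).[psi]%:C = 1.
    rewrite /Ppoly /= (ppoly1 R x hG); last by lia.
    by rewrite -['X]mul1r odd_polyMX even_polyC hornerC.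
  have PS j : (j.+2 <= diameter e)%N ->
      (cnum e j.+2)%:R * (Ppoly R e j.+2).[psi]%:C
      + (bnum e j.+2)%:R * (Ppoly R e j).[psi]%:C
      = (if odd j then 1 else psi%:C) * (Ppoly R e j.+1).[psi]%:C.
    move=> jD; have := Ppoly_rec R x hG hval jD => /(congr1 (fun p => p.[psi]%:C)).
    rewrite hornerD !hornerZ hornerM rmorphD !rmorphM /= !(rmorph_nat (real_complex R)).
    by move=> ->; case: odd; rewrite ?(hornerC, hornerX).
  have nf := P_neq0 (D := diameter e) (b := bC) (c := cC) (N := NC) (P := PC) hD c1 b0 bDc c_neq0 b_neq0 a0 n0 nS aS nN' N_neq0 P0 P1 PS
    eta_neq' psiE (D2 i iD).
  split; first by move: nf; rewrite (inj_eq (@complexI R)).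
  have := norm_formula (b := bC) (c := cC) (N := NC) (K := KC) (P := PC) hD c1 b0 bDc c_neq0 b_neq0 K0 KS a0 n0 nS aS nN' N_neq0
    P0 P1 PS eta_neq' psiE (D2 i iD).
  rewrite /NC w0E => ->; congr (_ * _).
  rewrite /KC; move: (knum R e i) => Ki.
  rewrite !(rmorphM, fmorphV, rmorphB) /= !(rmorph_nat (real_complex R)).
  by [].
- have eta1' : eta%:C = -1 by rewrite eta1 rmorphN1.
  have := norm_formula_degenerate (b := bC) (c := cC) (N := NC) (K := KC) hD b0 bDc c_neq0 b_neq0 K0 KS a0 n0 nS aS nN'
    N_neq0 eta1' (D2 i iD).
  rewrite /NC w0E => ->; congr (_ * _).
  rewrite /KC; move: (knum R e i) => Ki.
  by rewrite !(rmorphM, fmorphV) /= !(rmorph_nat (real_complex R)).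
Qed.
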